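(* Suppose that $\varepsilon\ge0$, $\mathbf{v}\equiv\hat{\mathbf{v}}$, $c\equiv0$, $f\equiv\hat f$ with constants $\hat{\mathbf{v}}\in\mathbb{R}^d\setminus\{\mathbf 0\}$ and $\hat f\in\mathbb{R}\setminus\{0\}$, and let $$\hat u(\mathbf{x})=\hat f\,\frac{\mathbf{x}\cdot\hat{\mathbf{v}}}{|\hat{\mathbf{v}}|^2}.$$ Then for the vector $u\in\mathbb{R}^{N_h}$ of nodal values $u_i=\hat u(\mathbf{x}_i)$, $i=1,\dots,N_h$, one has $\alpha_{ij}=1$ and $f_{ij}^s=0=f_{ij}^{s,*}$ for all $i\in\{1,\dots,M_h\}$ and $j\in\mathcal N_i\setminus\{i\}$. Consequently, at this $u$ the flux-corrected scheme coincides with the standard Galerkin discretization, and it preserves the equilibrium $\hat u$ (it is well balanced), i.e., for $i=1,\dots,M_h$, $$a_i^Ru_i-\sum_{j\in\mathcal N_i\setminus\{i\}}\big[2d_{ij}(\bar u_{ij}^{s,*}-u_i)-a_{ij}^D(u_j-u_i)\big]=\sum_{j=1}^{N_h}(a_{ij}^D+a_{ij}^C+a_{ij}^R)u_j-b_i=0.$$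
   Context: **Problem data.** $d\in\{1,2,3\}$; $\Omega\subset\mathbb{R}^d$ is a bounded polytopal domain with Lipschitz boundary $\Gamma=\partial\Omega$. The continuous problem is $-\varepsilon\Delta u+\mathbf{v}\cdot\nabla u+cu=f$ in $\Omega$, $u=u_D$ on $\Gamma_D$, with constant $\varepsilon\ge 0$. For $\varepsilon>0$ one has $\Gamma_D=\Gamma$; for $\varepsilon=0$, $\Gamma_D\subseteq\Gamma$ is the inflow boundary. **Mesh and finite elements.** $\mathcal T_h$ is a conforming simplex mesh with $\bigcup_{K\in\mathcal T_h}K=\overline\Omega$, vertices $\mathbf{x}_1,\dots,\mathbf{x}_{N_h}$, maximal cell diameter $h>0$. $\varphi_j\in C(\overline\Omega)$ are the piecewise linear Lagrange basis functions, $\varphi_j|_K\in\mathbb{P}_1(K)$ for all $K\in\mathcal T_h$, $\varphi_j(\mathbf{x}_i)=\delta_{ij}$. A vector $u=(u_1,\dots,u_{N_h})^\top$ is identified with $u_h=\sum_{j=1}^{N_h}u_j\varphi_j$. The vertices lying on the Dirichlet boundary are exactly those with indices $M_h+1,\dots,N_h$. $\mathcal N_i$ is the set of indices $j$ such that $\varphi_i,\varphi_j$ have overlapping supports, i.e. $\mathbf{x}_i,\mathbf{x}_j$ belong to a common mesh cell (so $i\in\mathcal N_i$). **Matrices.** $a_{ij}^D=\varepsilon\int_\Omega\nabla\varphi_i\cdot\nabla\varphi_j\,d\mathbf{x}$, $a_{ij}^C=\int_\Omega\varphi_i\,\mathbf{v}\cdot\nabla\varphi_j\,d\mathbf{x}$,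 $a_{ij}^R=\int_\Omega c\,\varphi_i\varphi_j\,d\mathbf{x}$, $b_i=\int_\Omega\varphi_i f\,d\mathbf{x}$, $a_i^R=\sum_{j\in\mathcal N_i}a_{ij}^R$. The standard Galerkin discretization is $\sum_{j=1}^{N_h}(a_{ij}^D+a_{ij}^C+a_{ij}^R)u_j=b_i$, $i=1,\dots,M_h$. With a fixed constant $\delta>0$, for $j\in\mathcal N_i\setminus\{i\}$: $d_{ij}=\max\{|a_{ij}^C|,\delta h^{d-1},|a_{ji}^C|\}$; $a_i^C=\sum_{j\in\mathcal N_i\setminus\{i\}}2d_{ij}>0$. **Standing assumption.** $a_{ij}^D\le 0$ for all $i\ne j$ in $\{1,\dots,N_h\}$. $|\cdot|$ is the Euclidean norm. **Well-balanced (WMC) scheme.** All following quantities are functions of $u\in\mathbb{R}^{N_h}$. For $i=1,\dots,N_h$ and $j\in\mathcal N_i\setminus\{i\}$, with $s_i=f(\mathbf{x}_i)-c(\mathbf{x}_i)u_i$, $$\bar u_{ij}=\frac{u_j+u_i}{2}-\frac{a_{ij}^C(u_j-u_i)}{2d_{ij}},\qquad P_{ij}=\frac12\,\frac{s_i+s_j}{2}\,\frac{(\mathbf{x}_i-\mathbf{x}_j)\cdot(\mathbf{v}(\mathbf{x}_i)+\mathbf{v}(\mathbf{x}_j))}{2(\max\{|\mathbf{v}(\mathbf{x}_i)|,|\mathbf{v}(\mathbf{x}_j)|\})^2}.$$ For $i\le M_h$, $j\in\mathcal N_i\setminus\{i\}$, fix a mesh cell $K_j^i$ containing $\mathbf{x}_i$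 that is intersected by the half line $\{\mathbf{x}_i+\theta(\mathbf{x}_i-\mathbf{x}_j):\theta>0\}$ (such a cell is assumed to exist; this is automatic when $\mathbf{x}_i$ is an interior vertex), and set $u_j^i=u_i+\nabla u_h|_{K_j^i}\cdot(\mathbf{x}_i-\mathbf{x}_j)$. Define, for $i\le M_h$, $$Q_{ij}^+=\max\Big\{\tfrac{u_j^i-u_i}{2},\max\{u_i,u_j\}-\bar u_{ij}-\tfrac{b_i}{a_i^C}\Big\},\quad Q_{ij}^-=\min\Big\{\tfrac{u_j^i-u_i}{2},\min\{u_i,u_j\}-\bar u_{ij}-\tfrac{b_i}{a_i^C}\Big\},$$ $R_{ij}=Q_{ij}^+/P_{ij}$ if $b_i\le0$ and $P_{ij}>Q_{ij}^+$; $R_{ij}=Q_{ij}^-/P_{ij}$ if $b_i\ge0$ and $P_{ij}<Q_{ij}^-$; $R_{ij}=1$ otherwise. For $i>M_h$, $R_{ij}=1$. Set $\alpha_{ij}=\min\{R_{ij},R_{ji}\}$. For $i\le M_h$, $j\in\mathcal N_i\setminus\{i\}$: $$\bar u_{ij}^s=\bar u_{ij}+\alpha_{ij}P_{ij}+\frac{b_i}{a_i^C},\qquad f_{ij}^s=2d_{ij}\Big[\frac{u_i-u_j}{2}-\alpha_{ij}P_{ij}\Big]+a_{ij}^R(u_i-u_j),$$ $\bar u_i^{\min}=\min_{j\in\mathcal N_i\setminus\{i\}}\bar u_{ij}^s$, $\bar u_i^{\max}=\max_{j\in\mathcal N_i\setminus\{i\}}\bar u_{ij}^s$. The limited fluxes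 are: $f_{ij}^{s,*}=0$ if $f_{ij}^s=0$; if $i,j\le M_h$, $$f_{ij}^{s,*}=\begin{cases}\min\{f_{ij}^s,\,2d_{ij}(\bar u_i^{\max}-\bar u_{ij}^s),\,2d_{ij}(\bar u_{ji}^s-\bar u_j^{\min})\}& f_{ij}^s>0,\\ \max\{f_{ij}^s,\,2d_{ij}(\bar u_i^{\min}-\bar u_{ij}^s),\,2d_{ij}(\bar u_{ji}^s-\bar u_j^{\max})\}& f_{ij}^s<0,\end{cases}$$ and if $i\le M_h<j$, $$f_{ij}^{s,*}=\begin{cases}\min\{f_{ij}^s,\,2d_{ij}(\bar u_i^{\max}-\bar u_{ij}^s)\}& f_{ij}^s>0,\\ \max\{f_{ij}^s,\,2d_{ij}(\bar u_i^{\min}-\bar u_{ij}^s)\}& f_{ij}^s<0.\end{cases}$$ Finally $\bar u_{ij}^{s,*}=\bar u_{ij}^s+f_{ij}^{s,*}/(2d_{ij})$. The WMC scheme consists of the equations $a_i^Ru_i-\sum_{j\in\mathcal N_i\setminus\{i\}}[2d_{ij}(\bar u_{ij}^{s,*}-u_i)-a_{ij}^D(u_j-u_i)]=0$, $i=1,\dots,M_h$, together with $u_i=u_D(\mathbf{x}_i)$, $i=M_h+1,\dots,N_h$. *)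

(* Defs.v *)
From HB Require Import structures.
From mathcomp Require Import all_boot all_order all_algebra.
From mathcomp Require Import all_classical all_reals all_analysis.
Set Implicit Arguments.
Unset Strict Implicit.
Unset Printing Implicit Defensive.
Import Order.TTheory GRing.Theory Num.Theory.
Import numFieldNormedType.Exports.
Local Open Scope classical_set_scope.
Local Open Scope ring_scope.

Section lebesgue_tuple.
Variable R : realType.
Notation tup n := (n.-tuple (measurableTypeR R)).

Section cons_measure.
Variables (n : nat) (m : {sigma_finite_measure set (tup n) -> \bar R}).

Definition tcons (p : measurableTypeR R * tup n) : tup n.+1 :=
  [the n.+1.-tuple _ of p.1 :: p.2].

Lemma measurable_tcons : measurable_fun setT tcons.
Proof. exact: measurable_cons. Qed.

Definition cons_measure : set (tup n.+1) -> \bar R :=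
  pushforward (lebesgue_measure \x m)%E tcons.

Let cons_measure0 : cons_measure set0 = 0%E.
Proof. by rewrite /cons_measure /pushforward preimage_set0 measure0. Qed.

Let cons_measure_ge0 A : (0 <= cons_measure A)%E.
Proof. by rewrite /cons_measure /pushforward measure_ge0. Qed.

Let cons_measure_sigma_additive : semi_sigma_additive cons_measure.
Proof.
exact: (@measure_semi_sigma_additive _ _ _
  (measure_function_pushforward__canonical__measure_function_Measure
    (lebesgue_measure \x m)%E measurable_tcons)).
Qed.

HB.instance Definition _ := isMeasure.Build _ _ _ cons_measure
  cons_measure0 cons_measure_ge0 cons_measure_sigma_additive.

Let cons_measure_sigma_finite : sigma_finite setT cons_measure.
Proof.
have /sigma_finiteP[F [UF ndF mF]] := sigma_finiteT (@lebesgue_measure R).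
have /sigma_finiteP[G [UG ndG mG]] := sigma_finiteT m.
pose uncons (t : tup n.+1) := (thead t, [tuple of behead t]).
have unconsK p : uncons (tcons p) = p.
  by case: p => a b; congr (_, _); apply: val_inj.
exists (fun k => uncons @^-1` (F k `*` G k)).
  apply/seteqP; split => // t _.
  have [i _ Fi] : (\bigcup_i F i) (thead t) by rewrite -UF.
  have [j _ Gj] : (\bigcup_j G j) [tuple of behead t] by rewrite -UG.
  exists (maxn i j) => //; split => /=.
    by have /subsetPset := ndF _ _ (leq_maxl i j); apply.
  by have /subsetPset := ndG _ _ (leq_maxr i j); apply.
move=> k; have [mFk Fk] := mF k; have [mGk Gk] := mG k; split.
  rewrite -[X in measurable X]setTI.
  have : measurable_fun setT uncons.
    apply: measurable_fun_pair; first exact: measurable_tnth.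
    exact: measurable_behead.
  by apply => //; exact: measurableX.
rewrite /cons_measure /pushforward -comp_preimage.
rewrite (_ : uncons \o tcons = id); last exact/funext.
by rewrite product_measure1E// lte_mul_pinfty// ge0_fin_numE.
Qed.

HB.instance Definition _ :=
  Measure_isSigmaFinite.Build _ _ _ cons_measure cons_measure_sigma_finite.
End cons_measure.

(* [lebesgue_tuple n] is the n-fold product of the one-dimensional Lebesgue
   measure, on the product (Borel) sigma-algebra of n.-tuple R. *)
Fixpoint lebesgue_tuple n : {sigma_finite_measure set (tup n) -> \bar R} :=
  if n is k.+1 then cons_measure (lebesgue_tuple k)
  else (\d_([tuple] : tup 0))%E.

Definition row_of_tuple n (t : tup n) : 'rV[R]_n := \row_k tnth t k.

(* Integral over D in R^n. The measurable structure lives on n.-tuple R and the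
   linear, topological and differential structures on 'rV[R]_n. *)
Definition integral_rV n (D : set 'rV[R]_n) (g : 'rV[R]_n -> R) : R :=
  \int[lebesgue_tuple n]_(t in [set t | D (row_of_tuple t)])
    g (row_of_tuple t).

End lebesgue_tuple.

Section euclidean.
Variables (R : realType) (d : nat).
Notation V := 'rV[R]_d.
Implicit Types (x y n p : V) (A Om : set V).

Definition dot x y : R := \sum_k x 0 k * y 0 k.

(* The library norm `|x| on 'rV[R]_d is the sup norm. *)
Definition enorm x : R := Num.sqrt (dot x x).

Definition diam A : R := sup [set r | exists x y, [/\ A x, A y & r = enorm (x - y)]].

(* Classical gradient. For a piecewise linear function it is meaningful off the
   mesh skeleton, a Lebesgue null set on which its value is irrelevant. *)
Definition grad (g : V -> R) x : V := \row_k 'D_(delta_mx 0 k) g x.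

Definition convex_hull (I : finType) (x : I -> V) (K : {set I}) : set V :=
  [set y | exists l : I -> R,
     [/\ forall i, i \in K -> 0 <= l i,
         \sum_(i in K) l i = 1 &
         y = \sum_(i in K) l i *: x i]].

Definition affinely_independent (I : finType) (x : I -> V) (K : {set I}) :=
  forall l : I -> R, \sum_(i in K) l i = 0 -> \sum_(i in K) l i *: x i = 0 ->
    forall i, i \in K -> l i = 0.

Definition boundary A : set V := closure A `\` A°.

Definition polytopal Om := exists m (x : 'I_m -> V) (S : {set {set 'I_m}}),
  closure Om = \bigcup_(K in [set K | K \in S]) convex_hull x K.

(* Near each boundary point Om is the strict hypograph, in the direction n, of
   a Lipschitz function g of the coordinates orthogonal to n. *)
Definition lipschitz_boundary Om := forall p, boundary Om p ->
  exists (n : V) (L : R) (g : V -> R),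
    [/\ enorm n = 1,
        forall y (t : R), g (y + t *: n) = g y,
        forall y z, `|g y - g z| <= L * enorm (y - z) &
        \forall y \near p, Om y <-> dot y n < g y].

Definition polytopal_lipschitz_domain Om :=
  [/\ open Om, connected Om & Om !=set0] /\
  [/\ bounded_set Om, polytopal Om & lipschitz_boundary Om].

(* A polytopal domain has an outward unit normal n at p exactly when it is, near
   p, the half space {y | (y - p) . n < 0}; this holds in the relative interior
   of the faces. *)
Definition outward_normal Om p n :=
  enorm n = 1 /\ \forall y \near p, Om y <-> dot (y - p) n < 0.

Definition inflow_part Om (v : V -> V) : set V :=
  [set p | boundary Om p /\ exists n, outward_normal Om p n /\ dot (v p) n < 0].

End euclidean.

(* Data of -eps Lap u + vel . grad u + react u = src in Omega
   with Dirichlet conditions on GammaD; the boundary values enter only the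
   equations of the Dirichlet vertices. *)
Record problem (R : realType) (d : nat) := Problem {
  Omega : set 'rV[R]_d;
  GammaD : set 'rV[R]_d;
  eps : R;
  vel : 'rV[R]_d -> 'rV[R]_d;
  react : 'rV[R]_d -> R;
  src : 'rV[R]_d -> R }.

(* The outward normal is undefined at the vertices of a polytope, so for eps = 0
   the formula vel . n < 0 determines the inflow boundary up to points of the
   closure of [inflow_part]; every choice in between is allowed. *)
Definition problem_wf (R : realType) (d : nat) (p : problem R d) :=
  [/\ polytopal_lipschitz_domain (Omega p),
      0 <= eps p,
      0 < eps p -> GammaD p = boundary (Omega p) &
      eps p = 0 -> inflow_part (Omega p) (vel p) `<=` GammaD p /\
                   GammaD p `<=` closure (inflow_part (Omega p) (vel p))].

(* N = N_h and nfree = M_h, with indices starting from 0: the vertex i is free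
   when i < nfree and a Dirichlet vertex otherwise. A cell is the set of the
   indices of its vertices. [upwind_cell i j] is K^i_j, relevant for i < nfree
   only. *)
Record discretization (R : realType) (d N : nat) := Discretization {
  vertex : 'I_N -> 'rV[R]_d;
  cells : {set {set 'I_N}};
  basis : 'I_N -> 'rV[R]_d -> R;
  nfree : nat;
  delta : R;
  upwind_cell : 'I_N -> 'I_N -> {set 'I_N} }.

Section scheme.
Variables (R : realType) (d N : nat).
Variables (p : problem R d) (t : discretization R d N).
Implicit Types (i j : 'I_N) (K : {set 'I_N}) (u : 'I_N -> R).

Notation Om := (Omega p).
Notation x := (vertex t).
Notation phi := (basis t).
Notation v := (vel p).
Notation c := (react p).
Notation f := (src p).

Definition cell K : set 'rV[R]_d := convex_hull x K.

Definition conforming_simplex_mesh :=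
  [/\ injective x,
      forall i, exists2 K, K \in cells t & i \in K,
      forall K, K \in cells t -> #|K| = d.+1 /\ affinely_independent x K,
      forall K K', K \in cells t -> K' \in cells t ->
        cell K `&` cell K' = cell (K :&: K') &
      \bigcup_(K in [set K | K \in cells t]) cell K = closure Om].

Definition lagrange_basis := forall j,
  [/\ {within closure Om, continuous (phi j)},
      forall K, K \in cells t -> exists (a : 'rV[R]_d) (b : R),
        forall y, cell K y -> phi j y = dot a y + b &
      forall i, phi j (x i) = (i == j)%:R].

Definition dirichlet_vertices :=
  (nfree t <= N)%N /\ forall i, (nfree t <= i)%N <-> GammaD p (x i).

Definition nbr i : {set 'I_N} :=
  [set j | [exists K in cells t, (i \in K) && (j \in K)]].

Definition nbr' i : {set 'I_N} := nbr i :\ i.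

Definition upwind_cells_wf := forall i j, (i < nfree t)%N -> j \in nbr' i ->
  [/\ upwind_cell t i j \in cells t,
      cell (upwind_cell t i j) (x i) &
      exists2 theta : R, 0 < theta &
        cell (upwind_cell t i j) (x i + theta *: (x i - x j))].

Definition mesh_size : R := \big[Num.max/0]_(K in cells t) diam (cell K).

Definition aD i j : R :=
  eps p * integral_rV Om (fun y => dot (grad (phi i) y) (grad (phi j) y)).
Definition aC i j : R :=
  integral_rV Om (fun y => phi i y * dot (v y) (grad (phi j) y)).
Definition aR i j : R := integral_rV Om (fun y => c y * phi i y * phi j y).
Definition load i : R := integral_rV Om (fun y => phi i y * f y).

Definition discretization_wf :=
  [/\ conforming_simplex_mesh, lagrange_basis, dirichlet_vertices,
      upwind_cells_wf & 0 < delta t] /\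
  forall i j, i != j -> aD i j <= 0.

Definition aR_row i : R := \sum_(j in nbr i) aR i j.

Definition dij i j : R :=
  Num.max `|aC i j| (Num.max (delta t * mesh_size ^+ d.-1) `|aC j i|).

Definition aC_row i : R := \sum_(j in nbr' i) 2 * dij i j.

Definition galerkin_residual u i : R :=
  \sum_j (aD i j + aC i j + aR i j) * u j - load i.

Definition fe_function u : 'rV[R]_d -> R := fun y => \sum_j u j * phi j y.

(* The gradient of the affine function g|_K, evaluated at the barycenter, which
   is interior to K. *)
Definition cell_grad (g : 'rV[R]_d -> R) K : 'rV[R]_d :=
  grad g (#|K|%:R^-1 *: \sum_(i in K) x i).

Section functions_of_u.
Variable u : 'I_N -> R.

Definition nodal_source i : R := f (x i) - c (x i) * u i.

Definition ubar i j : R :=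
  (u j + u i) / 2 - aC i j * (u j - u i) / (2 * dij i j).

Definition Pij i j : R :=
  1 / 2 * ((nodal_source i + nodal_source j) / 2) *
  (dot (x i - x j) (v (x i) + v (x j)) /
   (2 * Num.max (enorm (v (x i))) (enorm (v (x j))) ^+ 2)).

(* u^i_j *)
Definition uext i j : R :=
  u i + dot (cell_grad (fe_function u) (upwind_cell t i j)) (x i - x j).

Definition Qplus i j : R :=
  Num.max ((uext i j - u i) / 2)
          (Num.max (u i) (u j) - ubar i j - load i / aC_row i).
Definition Qminus i j : R :=
  Num.min ((uext i j - u i) / 2)
          (Num.min (u i) (u j) - ubar i j - load i / aC_row i).

Definition Rij i j : R :=
  if (i < nfree t)%N then
    if (load i <= 0) && (Qplus i j < Pij i j) then Qplus i j / Pij i j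
    else if (0 <= load i) && (Pij i j < Qminus i j) then Qminus i j / Pij i j
    else 1
  else 1.

Definition alpha i j : R := Num.min (Rij i j) (Rij j i).

Definition ubar_s i j : R := ubar i j + alpha i j * Pij i j + load i / aC_row i.

Definition flux_s i j : R :=
  2 * dij i j * ((u i - u j) / 2 - alpha i j * Pij i j) + aR i j * (u i - u j).

(* Minimum and maximum over a finite nonempty set of values. *)
Definition ubar_min i : R := inf [set ubar_s i j | j in [set j | j \in nbr' i]].
Definition ubar_max i : R := sup [set ubar_s i j | j in [set j | j \in nbr' i]].

(* f^{s,*}_ij, for i < nfree. *)
Definition flux_s_star i j : R :=
  if flux_s i j == 0 then 0
  else if (j < nfree t)%N then
    if 0 < flux_s i j then
      Num.min (flux_s i j)
        (Num.min (2 * dij i j * (ubar_max i - ubar_s i j))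
                 (2 * dij i j * (ubar_s j i - ubar_min j)))
    else
      Num.max (flux_s i j)
        (Num.max (2 * dij i j * (ubar_min i - ubar_s i j))
                 (2 * dij i j * (ubar_s j i - ubar_max j)))
  else
    if 0 < flux_s i j then
      Num.min (flux_s i j) (2 * dij i j * (ubar_max i - ubar_s i j))
    else
      Num.max (flux_s i j) (2 * dij i j * (ubar_min i - ubar_s i j)).

Definition ubar_s_star i j : R :=
  ubar_s i j + flux_s_star i j / (2 * dij i j).

Definition wmc_residual i : R :=
  aR_row i * u i -
  \sum_(j in nbr' i)
    (2 * dij i j * (ubar_s_star i j - u i) - aD i j * (u j - u i)).

End functions_of_u.
End scheme.

(* Main.v *)
Require Import Defs.
From HB Require Import structures.
From mathcomp Require Import all_boot all_order all_algebra.
From mathcomp Require Import all_classical all_reals all_analysis.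
From mathcomp Require Import measurable_realfun ring lra.
Set Implicit Arguments.
Unset Strict Implicit.
Unset Printing Implicit Defensive.
Import Order.TTheory GRing.Theory Num.Theory.
Import numFieldNormedType.Exports.
Import HBNNSimple.
Local Open Scope classical_set_scope.
Local Open Scope ring_scope.

(** On each cell the nodal interpolant of uhat is uhat itself, whose gradient g
    satisfies vhat . g = fhat. Hence P_ij = (u_i - u_j) / 2 = (u^i_j - u_i) / 2,
    which gives R_ij = 1, and all fluxes vanish. Both residuals then reduce to
    sum_j a^C_ij (u_j - u_i) = b_i, which is vhat . g = fhat integrated against
    phi_i, and sum_j a^D_ij (u_j - u_i) = 0, that is, eps int_Om grad phi_i . g = 0.

    For eps > 0 the latter needs phi_i = 0 on the boundary. Extended by zero,
    phi_i is then Lipschitz with compact support, so its difference quotients in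
    the direction g have integral 0 by translation invariance, and dominated
    convergence gives the claim. Integrals over Om are split over the open
    cells, whose complement in the closure of Om lies in finitely many
    hyperplanes. *)

(** * Lebesgue measure on tuples *)

(** Translation invariance stands in for Green's formula, which on a polytope would call for traces
    and face normals. The price is that the zero extension of phi_i must be globally Lipschitz, and
    this is where the boundary regularity enters. If Om had a slit, its closure would swallow the
    slit, the cells would cover it, and phi_i could be positive there, so that the zero extension
    would jump. A Lipschitz boundary forces the interior of the closure back into Om; a boundary
    point with phi_i > 0 can then be excluded by showing that the cells fill a neighbourhood of it.

    No integral is ever evaluated. Since sum_j u_j grad phi_j = g on every cell, convection and load
    agree cell by cell with the integrals of phi_i left symbolic, and only the diffusion term needs
    an argument across cells. *)

Lemma ge0_le_integral_off_null (d : measure_display) (T : measurableType d)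
    (R : realType) (mu : {measure set T -> \bar R}) (N : set T)
    (f g : T -> \bar R) :
  measurable N -> mu N = 0%E ->
  (forall x, 0 <= f x)%E -> (forall x, 0 <= g x)%E ->
  (forall x, ~ N x -> f x = g x) ->
  (\int[mu]_x f x <= \int[mu]_x g x)%E.
Proof.
move=> mN N0 f0 g0 fg; rewrite (ge0_integralTE _ f0).
apply: ge_ereal_sup => _ [h /= hf <-].
(* A simple function below [f], set to zero on [N], keeps its integral and lies below [g]. *)
pose h' := mul_nnsfun h (indic_nnsfun R (measurableC mN)).
rewrite -integralT_nnsfun (ge0_negligible_integral mN) //; last 2 first.
- exact/measurable_EFinP.
- by move=> x _; rewrite lee_fin.
have h'E x : h' x = h x * (x \in ~` N)%:R by [].
have -> : (\int[mu]_(x in setT `\` N) (h x)%:E = \int[mu]_x (h' x)%:E)%E.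
  rewrite integral_mkcond; apply: eq_integral => x _.
  rewrite h'E /patch setTD; case: ifP => _; first by rewrite mulr1.
  by rewrite mulr0.
rewrite integralT_nnsfun (ge0_integralTE _ g0); apply: ereal_sup_ubound.
exists h' => //= x; rewrite -[X in (X%:E <= _)%E]/(h' x) h'E.
have [Nx|Nx] := pselect (N x).
  by rewrite memNset ?mulr0 ?g0 //; exact.
by rewrite mem_set ?mulr1 -?fg.
Qed.

(* The integral of any nonnegative function, measurable or not, is the supremum
   of the integrals of the simple functions below it. This matters for the
   classical gradients, which take uncontrolled values on the mesh skeleton. *)
Lemma eq_integral_off_null (d : measure_display) (T : measurableType d)
    (R : realType) (mu : {measure set T -> \bar R}) (D N : set T)
    (f g : T -> \bar R) :
  measurable N -> mu N = 0%E ->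
  (forall x, D x -> ~ N x -> f x = g x) ->
  (\int[mu]_(x in D) f x = \int[mu]_(x in D) g x)%E.
Proof.
move=> mN N0 fg; rewrite integral_mkcond [RHS]integral_mkcond.
have {}fg x : ~ N x -> (f \_ D) x = (g \_ D) x.
  by move=> Nx; rewrite /patch; case: ifPn => // /[!inE] Dx; rewrite fg.
rewrite integralE [RHS]integralE.
congr (_ - _)%E; apply/eqP; rewrite eq_le; apply/andP; split;
  apply: (ge0_le_integral_off_null mN N0) => // x Nx;
  by rewrite ?funeposE ?funenegE fg.
Qed.

(** * Translation invariance of the product measure *)

Section lebesgue_tuple_theory.
Variable R : realType.
Notation tup n := (n.-tuple (measurableTypeR R)).

Definition tadd n (c t : tup n) : tup n := [tuple tnth c i + tnth t i | i < n].

Lemma tadd_tcons n (c : tup n.+1) x (t : tup n) :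
  tadd c (tcons (x, t)) = tcons (thead c + x, tadd [tuple of behead c] t).
Proof.
apply: eq_from_tnth => i; rewrite tnth_mktuple.
have [->|] := eqVneq i ord0; first by [].
rewrite eq_sym => /unlift_some[j -> _].
rewrite !tnthS tnth_mktuple tnth_behead; congr (tnth c _ + _).
by apply: val_inj; rewrite /= inordK ?ltnS ?(ltn_ord j).
Qed.

Lemma measurable_tadd n (c : tup n) : measurable_fun setT (tadd c).
Proof.
apply/measurable_fun_tnthP => i.
rewrite (_ : _ \o _ = fun t => tnth c i + tnth t i); last first.
  by apply/funext => t /=; rewrite tnth_mktuple.
by apply: measurable_funD => //; exact: measurable_tnth.
Qed.

(** Uniqueness of Lebesgue measure: the pushforward under the shift has the right value on half-open
    intervals. *)
Lemma lebesgue_measure_shift (c : R) (A : set (measurableTypeR R)) :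
  measurable A -> lebesgue_measure [set x | A (c + x)] = lebesgue_measure A.
Proof.
have ms : measurable_fun setT (fun x : measurableTypeR R => c + x : measurableTypeR R).
  exact: measurable_funD.
move=> mA; apply/esym.
apply: (@lebesgue_measure_unique R
  (measure_function_pushforward__canonical__measure_function_Measure
    lebesgue_measure ms)) => // X /ocitvP[->|[[a b]] /= ab ->].
  by rewrite !measure0.
rewrite /pushforward (_ : _ @^-1` _ = `](a - c), (b - c)]%classic).
  by rewrite !lebesgue_measure_itv/= !lte_fin ltrD2r ab -!EFinD; congr (_%:E); lra.
by apply/seteqP; split=> x /=; rewrite !in_itv/= ltrBlDl lerBrDl.
Qed.

Lemma ge0_integral_lebesgue_shift (c : R) (g : measurableTypeR R -> \bar R) :
  measurable_fun setT g -> (forall x, 0 <= g x)%E ->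
  (\int[lebesgue_measure]_x g (c + x)%R = \int[lebesgue_measure]_x g x)%E.
Proof.
have ms : measurable_fun setT (fun x : measurableTypeR R => c + x : measurableTypeR R).
  exact: measurable_funD.
move=> mg g0; have := @ge0_integral_pushforward _ _ _ _ _ _ ms
  lebesgue_measure setT g measurableT mg (fun x _ => g0 x).
rewrite preimage_setT /= => <-.
apply: (@eq_measure_integral _ _ _ _ lebesgue_measure
  (measure_function_pushforward__canonical__measure_function_Measure
    lebesgue_measure ms)) => A mA _.
exact: lebesgue_measure_shift.
Qed.

(** Cavalieri's form of the recursion, on which the inductions on the dimension for shifts and
    hyperplanes rest. *)
Lemma lebesgue_tupleS n (A : set (tup n.+1)) :
  lebesgue_tuple R n.+1 A =
  (\int[lebesgue_measure]_x lebesgue_tuple R n [set t | A (tcons (x, t))])%E.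
Proof.
rewrite /= /cons_measure /pushforward /product_measure1.
by apply: eq_integral => x _ /=; rewrite xsectionE.
Qed.

Lemma measurable_fun_lebesgue_section n (A : set (tup n.+1)) : measurable A ->
  measurable_fun setT
    (fun x : measurableTypeR R => lebesgue_tuple R n [set t | A (tcons (x, t))]).
Proof.
move=> mA; have mtA : measurable (@tcons R n @^-1` A).
  by rewrite -[X in measurable X]setTI; apply: measurable_tcons.
have := measurable_fun_xsection (lebesgue_tuple R n) mtA.
by apply: eq_measurable_fun => x _ /=; rewrite xsectionE.
Qed.

Lemma measurable_lebesgue_section n (A : set (tup n.+1)) x : measurable A ->
  measurable [set t : tup n | A (tcons (x, t))].
Proof.
move=> mA; have mtA : measurable (@tcons R n @^-1` A).
  by rewrite -[X in measurable X]setTI; apply: measurable_tcons.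
by have := measurable_xsection x mtA; rewrite xsectionE.
Qed.

Lemma lebesgue_tuple_shift n (c : tup n) (A : set (tup n)) : measurable A ->
  lebesgue_tuple R n [set t | A (tadd c t)] = lebesgue_tuple R n A.
Proof.
elim: n c A => [|n IH] c A mA.
  by congr (lebesgue_tuple R 0 _); apply/seteqP; split => t /=;
    rewrite (tuple0 (tadd c t)) (tuple0 t).
rewrite !lebesgue_tupleS.
pose F x := lebesgue_tuple R n [set t | A (tcons (x, t))].
(* The outer integral absorbs the shift of the first coordinate; the remaining ones are left to the
   induction hypothesis, section by section. *)
rewrite -(@ge0_integral_lebesgue_shift (thead c) F); first last.
- by move=> x; exact: measure_ge0.
- exact: measurable_fun_lebesgue_section.
apply: eq_integral => x _; rewrite /F.
rewrite -[RHS](IH [tuple of behead c]); last exact: measurable_lebesgue_section.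
by congr (lebesgue_tuple R n _); apply/seteqP; split => t /=; rewrite tadd_tcons.
Qed.

End lebesgue_tuple_theory.

Lemma measurable_forall (d : measure_display) (T : measurableType d)
    (I : finType) (F : I -> set T) :
  (forall i, measurable (F i)) -> measurable [set t | forall i, F i t].
Proof.
move=> mF; rewrite (_ : [set _ | _] = ~` \bigcup_i ~` F i).
  apply/measurableC/countable_bigcupT_measurable => [|i]; first exact: countableP.
  exact: measurableC.
apply/seteqP; split => t /= h; first by case=> i _; apply.
by move=> i; apply: contrapT => Fi; apply: h; exists i.
Qed.

(** * Measurable sets, hyperplanes and boxes in R^n *)

Section lebesgue_tuple_sets.
Variable R : realType.
Notation tup n := (n.-tuple (measurableTypeR R)).

Lemma dot_row_of_tuple n (a : 'rV[R]_n) (t : tup n) :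
  dot a (row_of_tuple t) = \sum_k a 0 k * tnth t k.
Proof. by apply: eq_bigr => k _; rewrite mxE. Qed.

Lemma row_of_tuple_tadd n (c t : tup n) :
  row_of_tuple (tadd c t) = row_of_tuple c + row_of_tuple t.
Proof. by apply/rowP => k; rewrite !mxE tnth_mktuple. Qed.

(** This links the topology of row vectors to the product sigma-algebra of tuples. By second
    countability [U] is the union of the countably many balls inside it with rational centre and
    radius 1/(k+1); for the sup norm these are cubes, measurable coordinate by coordinate. *)
Lemma measurable_open_row n (U : set 'rV[R]_n) : open U ->
  measurable [set t : tup n | U (row_of_tuple t)].
Proof.
move=> oU.
pose c (q : 'rV[rat]_n) : 'rV[R]_n := map_mx ratr q.
pose F (q : 'rV[rat]_n * nat) : set (tup n) :=
  if `[< ball (c q.1) q.2.+1%:R^-1 `<=` U >]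
  then [set t | ball (c q.1) q.2.+1%:R^-1 (row_of_tuple t)] else set0.
suff -> : [set t : tup n | U (row_of_tuple t)] = \bigcup_q F q.
  apply: countable_bigcupT_measurable => [|q]; first exact: countableP.
  rewrite /F; case: ifP => _; last exact: measurable0.
  set r := _^-1.
  have -> : [set t : tup n | ball (c q.1) r (row_of_tuple t)] =
      [set t : tup n | forall j, [set t : tup n | `|c q.1 0 j - tnth t j| < r] t].
    apply/seteqP; split => t /=.
      by move=> [_ tr] j; move: (tr 0 j); rewrite [row_of_tuple t _ _]mxE.
    move=> tr; split => [|i j]; first by rewrite invr_gt0 ltr0n.
    by move: (tr j); rewrite ord1 [row_of_tuple t _ _]mxE.
  apply: measurable_forall => j.
  rewrite -[X in measurable X]setTI.
  apply: (@measurable_fun_ltr _ _ _ _ _ (cst r) _ _ measurableT [set true]) => //.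
  apply: measurableT_comp => //; apply: measurable_funB => //.
  exact: measurable_tnth.
apply/seteqP; split => t /=; last first.
  by case=> q _; rewrite /F; case: ifPn => //= /asboolP; exact.
move=> Ut; have /nbhs_ballP[e /= e0 eU] := oU _ Ut.
(* With radius r < e/2, a ball whose centre is within r of [t] contains [t] and stays inside the
   ball of radius e about [t]. *)
have [k] := ltr_add_invr (divr_gt0 e0 (ltr0n R 2)).
rewrite add0r; set r := _^-1 => re.
have r0 : 0 < r by rewrite invr_gt0 ltr0n.
have qE (j : 'I_n) : {q : rat | `|ratr q - row_of_tuple t 0 j| < r}.
  apply: cid; have [|q] := @rat_in_itvoo R (row_of_tuple t 0 j - r) (row_of_tuple t 0 j + r).
    by lra.
  by rewrite in_itv/= => qr; exists q; rewrite ltr_distl.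
have tq : ball (c (\row_j sval (qE j))) r (row_of_tuple t).
  by split=> // i j; rewrite ord1 mxE mxE; exact: (svalP (qE j)).
exists (\row_j sval (qE j), k) => //; rewrite /F /=; case: asboolP => //.
case=> z zr; apply: eU; apply: (@le_ball _ _ _ (r + r)).
  by rewrite -/r in re; lra.
by apply: ball_triangle zr; exact: ball_sym.
Qed.

Lemma measurable_continuous_row n (g : 'rV[R]_n -> R) : continuous g ->
  measurable_fun setT (fun t : tup n => g (row_of_tuple t)).
Proof.
move=> cg mD; apply: (measurability _ (RGenOpens.measurableE R)) => //.
move=> _ [_ [a [b ->]] <-]; rewrite setTI.
set A := (X in measurable (_ @^-1` X)).
have oA : open A by exact: interval_open.
suff : open (g @^-1` A) by move=> /measurable_open_row.
by apply: open_comp => // x _; exact: cg.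
Qed.

Lemma measurable_affine_row n (a : 'rV[R]_n) (b : R) :
  measurable_fun setT (fun t : tup n => dot a (row_of_tuple t) + b).
Proof.
apply: measurable_funD => //; under eq_fun do rewrite dot_row_of_tuple.
by apply: measurable_sum => k; apply: measurable_funM => //; exact: measurable_tnth.
Qed.

Lemma measurable_hyperplane n (a : 'rV[R]_n) (b : R) :
  measurable [set t : tup n | dot a (row_of_tuple t) + b = 0].
Proof.
rewrite -[X in measurable X]setTI.
exact: (@measurable_affine_row n a b measurableT [set 0]).
Qed.

(** Induction on sections in the first coordinate. If the remaining coefficients [a'] are not all
    zero, every section is a hyperplane of lower dimension; otherwise the equation fixes the first
    coordinate. *)
Lemma hyperplane_null n (a : 'rV[R]_n) (b : R) : a != 0 ->
  lebesgue_tuple R n [set t | dot a (row_of_tuple t) + b = 0] = 0%E.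
Proof.
elim: n a b => [|n IH] a b a0.
  by move: a0; rewrite (_ : a = 0) ?eqxx//; apply/rowP => -[].
rewrite lebesgue_tupleS.
pose a' : 'rV[R]_n := \row_k a 0 (lift ord0 k).
have aE x (t : tup n) : dot a (row_of_tuple (tcons (x, t))) =
    a 0 ord0 * x + dot a' (row_of_tuple t).
  rewrite !dot_row_of_tuple big_ord_recl; congr (_ + _).
  by apply: eq_bigr => k _; rewrite mxE tnthS.
have [a'0|a'0] := eqVneq a' 0; last first.
  apply: integral0_eq => x _ /=.
  rewrite -[RHS](IH a' (a 0 ord0 * x + b) a'0).
  congr (lebesgue_tuple R n _); apply/seteqP; split => t /=; rewrite aE; lra.
have a00 : a 0 ord0 != 0.
  apply: contra_neq a0 => a00; apply/rowP => i; rewrite mxE.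
  have [->//|] := eqVneq i ord0; rewrite eq_sym => /unlift_some[j -> _].
  by move/rowP/(_ j): a'0; rewrite !mxE.
(* Over the single point - b / a_0 the section is the whole space, possibly of infinite measure, so
   the integrand vanishes only off a null set. *)
apply: (@etrans _ _ (\int[lebesgue_measure]_x (cst 0 x))%E); last exact: integral0.
apply: (@eq_integral_off_null _ (measurableTypeR R) R lebesgue_measure setT
  [set - b / a 0 ord0] _ (cst 0%E)) => [||x _ xb].
- exact: measurable_set1.
- exact: lebesgue_measure_set1.
rewrite (_ : [set t | _] = set0) ?measure0//.
apply/seteqP; split => t //=; rewrite aE a'0 /dot big1 => [|k _]; last first.
  by rewrite mxE mul0r.
rewrite addr0 => h; apply: xb => /=; apply: (mulfI a00).
by rewrite mulrCA divff// mulr1; lra.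
Qed.

Definition tbox n (M : R) : set (tup n) := [set t | forall i, `|tnth t i| <= M].

Lemma measurable_abs_le (M : R) :
  measurable [set x : measurableTypeR R | `|x| <= M].
Proof.
rewrite (_ : [set _ | _] = `[- M, M]%classic); first exact: measurable_itv.
by apply/seteqP; split => x /=; rewrite in_itv/= ler_norml.
Qed.

Lemma measurable_tbox n M : measurable (@tbox n M).
Proof.
apply: (@measurable_forall _ _ _ (fun j => [set t : tup n | `|tnth t j| <= M])) => j.
rewrite -[X in measurable X]setTI.
exact: (measurable_tnth j measurableT (measurable_abs_le M)).
Qed.

Lemma lebesgue_tbox_lty n M : (lebesgue_tuple R n (@tbox n M) < +oo)%E.
Proof.
elim: n => [|n IH].
  rewrite /= diracE; exact: ltry.
have mM := measurable_abs_le M.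
rewrite /= /cons_measure /pushforward.
rewrite (_ : _ @^-1` _ = [set x | `|x| <= M] `*` @tbox n M); last first.
  apply/seteqP; split; case=> x t /=.
    by move=> h; split=> [|i]; [exact: (h ord0)|have := h (lift ord0 i); rewrite tnthS].
  move=> [xM tM] i; have [->//|] := eqVneq i ord0.
  by rewrite eq_sym => /unlift_some[j -> _]; rewrite tnthS.
rewrite product_measure1E; [|exact: mM|exact: measurable_tbox].
apply: lte_mul_pinfty => //; rewrite ge0_fin_numE//.
rewrite (_ : [set x | _] = `[- M, M]%classic).
  by rewrite /= lebesgue_measure_itv/=; case: ifP => // _; rewrite -EFinB ltry.
by apply/seteqP; split => x /=; rewrite in_itv/= ler_norml.
Qed.

Lemma integral_tuple_shift n (c : tup n) (g : tup n -> \bar R) :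
  measurable_fun setT g -> (lebesgue_tuple R n).-integrable setT (g \o tadd c) ->
  (\int[lebesgue_tuple R n]_t g (tadd c t) = \int[lebesgue_tuple R n]_t g t)%E.
Proof.
move=> mg ig.
have ms := measurable_tadd c.
have := @integral_pushforward _ _ _ _ _ _ ms (lebesgue_tuple R n) setT g mg.
rewrite preimage_setT /= => /(_ ig measurableT) <-.
apply: (@eq_measure_integral _ _ _ _ (lebesgue_tuple R n)
  (measure_function_pushforward__canonical__measure_function_Measure
    (lebesgue_tuple R n) ms)) => A mA _.
exact: lebesgue_tuple_shift.
Qed.

End lebesgue_tuple_sets.

(** * Barycentric coordinates *)

Section dot_theory.
Variables (R : realType) (d : nat).
Implicit Types (x y z a : 'rV[R]_d) (c b : R).

Lemma dotC x y : dot x y = dot y x.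
Proof. by apply: eq_bigr => k _; rewrite mulrC. Qed.

Lemma dot_linear a c x y : dot a (c *: x + y) = c * dot a x + dot a y.
Proof.
rewrite /dot mulr_sumr -big_split; apply: eq_bigr => k _.
by rewrite !mxE /=; ring.
Qed.

Lemma dot0r a : dot a 0 = 0.
Proof. by apply: big1 => k _; rewrite mxE mulr0. Qed.

Lemma dotDr a x y : dot a (x + y) = dot a x + dot a y.
Proof. by rewrite -{1}[x]scale1r dot_linear mul1r. Qed.

Lemma dotZr a c x : dot a (c *: x) = c * dot a x.
Proof. by rewrite -{1}[c *: x]addr0 dot_linear dot0r addr0. Qed.

Lemma dotBr a x y : dot a (x - y) = dot a x - dot a y.
Proof. by rewrite dotDr -scaleN1r dotZr mulN1r. Qed.

Lemma dot0l a : dot 0 a = 0.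
Proof. by rewrite dotC dot0r. Qed.

Lemma dot_sumr (I : finType) (P : pred I) a (F : I -> 'rV[R]_d) :
  dot a (\sum_(i | P i) F i) = \sum_(i | P i) dot a (F i).
Proof. by apply: (big_morph (dot a)); [exact: dotDr|exact: dot0r]. Qed.

Lemma dot_suml (I : finType) (P : pred I) a (F : I -> 'rV[R]_d) :
  dot (\sum_(i | P i) F i) a = \sum_(i | P i) dot (F i) a.
Proof. by rewrite dotC dot_sumr; apply: eq_bigr => i _; rewrite dotC. Qed.

Lemma dot_delta a (k : 'I_d) : dot a (delta_mx 0 k) = a 0 k.
Proof.
rewrite /dot (bigD1 k)//= mxE !eqxx mulr1 big1 ?addr0// => j jk.
by rewrite mxE (negbTE jk) andbF mulr0.
Qed.

Lemma enorm_sqr x : enorm x ^+ 2 = dot x x.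
Proof. by rewrite sqr_sqrtr// sumr_ge0// => k _; rewrite -expr2 sqr_ge0. Qed.

Lemma dot_gt0 x : x != 0 -> 0 < dot x x.
Proof.
move=> x0; rewrite lt_neqAle sumr_ge0 ?andbT; last first.
  by move=> k _; rewrite -expr2 sqr_ge0.
apply: contra_neq x0 => /esym/eqP.
rewrite psumr_eq0 => [/allP h|k _]; last by rewrite -expr2 sqr_ge0.
apply/rowP => k; rewrite mxE; apply/eqP.
by have := h k (mem_index_enum k); rewrite mulf_eq0 orbb.
Qed.

Lemma coord_le_norm x (k : 'I_d) : `|x 0 k| <= `|x|.
Proof.
rewrite leNgt; apply/negP => xk.
have : ball (0 : 'rV[R]_d) `|x 0 k| x by rewrite mx_norm_ball /ball_ /= sub0r normrN.
by case=> _ /(_ 0 k); rewrite mxE -ball_normE /= sub0r normrN ltxx.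
Qed.

Lemma dot_le_norm a x : `|dot a x| <= (\sum_k `|a 0 k|) * `|x|.
Proof.
apply: (le_trans (ler_norm_sum _ _ _)); rewrite mulr_suml.
apply: ler_sum => k _; rewrite normrM ler_wpM2l//; exact: coord_le_norm.
Qed.

Lemma near_dist_le x b : 0 < b -> \forall y \near x, `|y - x| <= b.
Proof.
move=> b0; apply/nbhs_ballP; exists b => //= y.
by rewrite -ball_normE /ball_/= distrC => /ltW.
Qed.

Lemma lipschitz_at_cvg (g : 'rV[R]_d -> R) c x :
  (\forall y \near x, `|g y - g x| <= c * `|y - x|) -> g y @[y --> x] --> g x.
Proof.
move=> gc; apply: (cvgrPdist_le (FF := nbhs_filter x) _ _).2 => e e0.
(* The sign of [c] is unknown, so the radius is chosen with [|c| + 1]. *)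
have c0 : 0 < `|c| + 1 by rewrite ltr_wpDl.
near=> y.
have gy : `|g y - g x| <= c * `|y - x| by near: y.
have : `|y - x| <= e / (`|c| + 1) by near: y; apply/near_dist_le/divr_gt0.
rewrite ler_pdivlMr// => xy; rewrite distrC; apply: (le_trans gy).
apply: le_trans xy; rewrite mulrC ler_wpM2l//.
by rewrite (le_trans (ler_norm c))// lerDl.
Unshelve. all: by end_near.
Qed.

Lemma continuous_affine a b : continuous (fun y => dot a y + b).
Proof.
move=> x; apply: (@lipschitz_at_cvg _ (\sum_k `|a 0 k|)); near=> y.
rewrite opprD addrACA subrr addr0 -dotBr; exact: dot_le_norm.
Unshelve. all: by end_near. Qed.

Lemma affine_comb (I : finType) (l : I -> R) (x : I -> 'rV[R]_d) a b :
  \sum_i l i = 1 ->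
  dot a (\sum_i l i *: x i) + b = \sum_i l i * (dot a (x i) + b).
Proof.
move=> l1; rewrite dot_sumr -[in LHS](mul1r b) -l1 mulr_suml -big_split.
by apply: eq_bigr => i _; rewrite dotZr mulrDr.
Qed.

Lemma grad_affine (g : 'rV[R]_d -> R) a b y :
  (\forall z \near y, g z = dot a z + b) -> grad g y = a.
Proof.
move=> gE; apply/rowP => k; rewrite mxE /derive.
apply: norm_lim_near_cst.
have gy := nbhs_singleton gE.
have hh : \forall h \near (0 : R), g (h *: delta_mx 0 k + y) =
    dot a (h *: delta_mx 0 k + y) + b.
  have : (fun h : R => h *: delta_mx 0 k + y) x @[x --> (0:R)] --> y.
    rewrite -[X in _ --> X]add0r -(scale0r (delta_mx 0 k)).
    by apply: cvgD; [apply: cvgZr_tmp; exact: cvg_id|exact: cvg_cst].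
  by move=> /(_ _ gE).
near=> h.
have h0 : h != 0 by near: h; exact: nbhs_dnbhs_neq.
rewrite /= gy (_ : g _ = dot a (h *: delta_mx 0 k + y) + b); last first.
  by near: h; apply: nbhs_dnbhs.
rewrite dot_linear dot_delta /GRing.scale/=.
rewrite (_ : _ - _ = h * a 0 k); last by ring.
by rewrite mulKf.
Unshelve. all: by end_near. Qed.

End dot_theory.

Section barycentric.
Variables (R : realType) (d N : nat) (x : 'I_N -> 'rV[R]_d).
Implicit Types (K : {set 'I_N}) (y : 'rV[R]_d).

(** Affine independence says that the rows (x_i, 1), i in [K], are linearly independent. There are d
    + 1 of them in dimension d + 1, so (y, 1) is a combination of them; its last entry gives the sum
    of the weights. *)
Lemma affine_span K y : #|K| = d.+1 -> affinely_independent x K ->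
  exists l : 'I_N -> R, [/\ forall i, i \notin K -> l i = 0,
    \sum_i l i = 1 & y = \sum_i l i *: x i].
Proof.
move=> cK iK.
have [i0 i0K] : exists i, i \in K by apply/set0Pn; rewrite -card_gt0 cK.
pose X : 'M[R]_(#|K|, d) := \matrix_k x (enum_val k).
pose M : 'M[R]_(#|K|, d + 1) := row_mx X (const_mx 1).
pose coef (v : 'rV[R]_#|K|) i := if i \in K then v 0 (enum_rank_in i0K i) else 0.
have coefX v : \sum_(i in K) coef v i *: x i = v *m X.
  rewrite big_enum_val mulmx_sum_row; apply: eq_bigr => k _.
  by rewrite /coef enum_valP enum_valK_in rowK.
have coef1 v : \sum_(i in K) coef v i = (v *m (const_mx 1 : 'cV[R]_#|K|)) 0 0.
  rewrite big_enum_val mxE; apply: eq_bigr => k _.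
  by rewrite /coef enum_valP enum_valK_in mxE mulr1.
have fM : row_free M.
  apply: inj_row_free => v; rewrite mul_mx_row => /eqP.
  rewrite row_mx_eq0 => /andP[/eqP vX /eqP v1].
  have h : forall i, i \in K -> coef v i = 0.
    by apply: iK; rewrite ?coefX ?coef1 ?vX ?v1 ?mxE.
  apply/rowP => k; have := h _ (enum_valP k).
  by rewrite /coef enum_valP enum_valK_in mxE.
have /submxP[v] : (row_mx y (1%:M : 'M[R]_1) <= M)%MS.
  by apply: submx_full; rewrite /row_full (eqP fM) cK addn1.
rewrite mul_mx_row => /eq_row_mx[yE oneE].
have K0 (V : lmodType R) (F : 'I_N -> V) : (forall i, i \notin K -> F i = 0) ->
    \sum_i F i = \sum_(i in K) F i.
  by move=> F0; rewrite [RHS]big_mkcond; apply: eq_bigr => i _; case: ifPn => // /F0.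
have c0 i : i \notin K -> coef v i = 0 by rewrite /coef => /negbTE ->.
exists (coef v); split => //.
- by rewrite (K0 R^o (coef v))// coef1 -oneE mxE.
- by rewrite (K0 _ (fun i => coef v i *: x i)) ?coefX// => i /c0 ->; rewrite scale0r.
Qed.

(* The coordinate function y |-> dot (a j) y + b j is the affine extension of
   the restriction of the nodal basis function phi j to the simplex K. *)
Definition barycentric (phi : 'I_N -> 'rV[R]_d -> R) K
    (a : 'I_N -> 'rV[R]_d) (b : 'I_N -> R) :=
  [/\ forall j y, convex_hull x K y -> phi j y = dot (a j) y + b j,
      forall y, \sum_j (dot (a j) y + b j) = 1,
      forall y, y = \sum_j (dot (a j) y + b j) *: x j &
      forall j, j \notin K -> a j = 0 /\ b j = 0].

Lemma vertex_convex_hull K i : i \in K -> convex_hull x K (x i).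
Proof.
move=> iK; exists (fun j => (i == j)%:R); split.
- by move=> j _; rewrite ler0n.
- rewrite (bigD1 i)//= eqxx big1 ?addr0// => j /andP[_].
  by rewrite eq_sym => /negbTE ->.
- rewrite (bigD1 i)//= eqxx scale1r big1 ?addr0// => j /andP[_].
  by rewrite eq_sym => /negbTE ->; rewrite scale0r.
Qed.

(** An affine function is determined by its values at d + 1 affinely independent points, and the
    affine pieces of the basis functions have the Kronecker values at the vertices of [K]. For j
    outside [K] all these values are 0, so the affine function vanishes on the whole space. *)
Lemma barycentric_exists (phi : 'I_N -> 'rV[R]_d -> R) K :
  #|K| = d.+1 -> affinely_independent x K ->
  (forall j, exists (a : 'rV[R]_d) (b : R),
     forall y, convex_hull x K y -> phi j y = dot a y + b) ->
  (forall j i, phi j (x i) = (i == j)%:R) ->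
  exists ab, barycentric phi K ab.1 ab.2.
Proof.
move=> cK iK affphi phix.
have /choice[ab abE] : forall j, exists ab : 'rV[R]_d * R,
    forall y, convex_hull x K y -> phi j y = dot ab.1 y + ab.2.
  by move=> j; have [a [b h]] := affphi j; exists (a, b).
pose L j y := dot (ab j).1 y + (ab j).2.
have LE l y j : (forall i, i \notin K -> l i = 0) -> \sum_i l i = 1 ->
    y = \sum_i l i *: x i -> L j y = l j.
  move=> l0 l1 ->; rewrite /L affine_comb// (bigD1 j)//= big1 => [|i ij].
    have [jK|jK] := boolP (j \in K); last by rewrite l0// mul0r addr0.
    by rewrite -(abE j) ?phix ?eqxx ?mulr1 ?addr0//; exact: vertex_convex_hull.
  have [iK'|iK'] := boolP (i \in K); last by rewrite l0// mul0r.
  rewrite -(abE j); last exact: vertex_convex_hull.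
  by rewrite phix (negbTE ij) mulr0.
exists (fun j => (ab j).1, fun j => (ab j).2); split => /=.
- by move=> j y; exact: abE.
- move=> y; have [l [l0 l1 yE]] := affine_span y cK iK.
  by rewrite -[RHS]l1; apply: eq_bigr => j _; exact: LE.
- move=> y; have [l [l0 l1 yE]] := affine_span y cK iK.
  rewrite [LHS]yE; apply: eq_bigr => j _; congr (_ *: _).
  by apply/esym; exact: LE.
- move=> j jK; have L0 y : L j y = 0.
    have [l [l0 l1 yE]] := affine_span y cK iK.
    by rewrite (LE l y j l0 l1 yE) l0.
  have b0 : (ab j).2 = 0 by have := L0 0; rewrite /L dot0r add0r.
  split => //; apply/rowP => k; rewrite mxE.
  by have := L0 (delta_mx 0 k); rewrite /L b0 addr0 dot_delta.
Qed.

Section barycentric_theory.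
Variables (phi : 'I_N -> 'rV[R]_d -> R) (K : {set 'I_N}).
Variables (a : 'I_N -> 'rV[R]_d) (b : 'I_N -> R).
Hypothesis phix : forall j i, phi j (x i) = (i == j)%:R.
Hypothesis bK : barycentric phi K a b.
Let L j y := dot (a j) y + b j.

Lemma barycentric_vertex i j : i \in K -> L j (x i) = (i == j)%:R.
Proof.
case: bK => phiE _ _ _ iK; rewrite -phix /L -phiE//; exact: vertex_convex_hull.
Qed.

Lemma convex_hullP y : convex_hull x K y <-> forall j, 0 <= L j y.
Proof.
case: bK => phiE L1 Lx L0; split.
  move=> [l [l0 l1 yE]] j.
  rewrite /L yE dot_sumr -[b j]mul1r -l1 mulr_suml -big_split/= sumr_ge0//.
  move=> i iK; rewrite dotZr -mulrDr mulr_ge0 ?l0//.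
  by rewrite -/(L j (x i)) barycentric_vertex// ler0n.
move=> Ly; have K0 j : j \notin K -> L j y = 0.
  by move=> /L0[a0 b0]; rewrite /L a0 b0 dot0l addr0.
exists (fun j => L j y); split => //.
  rewrite -[RHS](L1 y) big_mkcond; apply: eq_bigr => j _.
  by case: ifPn => // /K0 <-.
rewrite [LHS]Lx [RHS]big_mkcond; apply: eq_bigr => j _.
by case: ifPn => // /K0; rewrite -/(L j y) => ->; rewrite scale0r.
Qed.

(** The interpolant of an affine function on a simplex is the function itself, so its gradient is
    [f]. This exactness collapses the sums over j of matrix entries times nodal values. *)
Lemma barycentric_sum (f : 'rV[R]_d) c :
  \sum_j (dot f (x j) + c) *: a j = f.
Proof.
case: bK => phiE L1 Lx L0.
have aff y : dot (\sum_j (dot f (x j) + c) *: a j) y =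
    dot f y + c - \sum_j (dot f (x j) + c) * b j.
  apply/eqP; rewrite eq_sym subr_eq eq_sym; apply/eqP.
  rewrite [in RHS](Lx y) affine_comb// dot_suml -big_split/=.
  by apply: eq_bigr => j _; rewrite dotC dotZr [dot y _]dotC; ring.
(* The value at 0 removes the constant terms; the linear parts are then compared on unit vectors. *)
have := aff 0; rewrite !dot0r => c0.
apply/rowP => k; rewrite -!dot_delta aff -addrA.
by rewrite add0r in c0; rewrite -c0 addr0.
Qed.

End barycentric_theory.
End barycentric.

(** * Topology of the mesh *)

Section segment_lipschitz.
Variable R : realType.

(** The radius of the local estimate depends on [t] and the estimate compares only with the centre,
    so no uniform subdivision is at hand. Let s be the supremum of the t in [0, 1] with
    [|h t - h 0| <= c * t]. The estimate at s carries the bound from points just below s to s, and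
    then beyond s unless s = 1. *)
Lemma lipschitz_of_local_R (h : R -> R) (c : R) :
  (forall t, \forall s \near t, `|h s - h t| <= c * `|s - t|) ->
  `|h 1 - h 0| <= c.
Proof.
move=> hl; pose A := [set t : R | 0 <= t <= 1 /\ `|h t - h 0| <= c * t].
have A0 : A 0 by split; rewrite ?lexx ?ler01// subrr normr0 mulr0.
have supA : has_sup A.
  by split; [exists 0|exists 1 => t [/andP[]]].
pose s := sup A.
have s0 : 0 <= s by apply: sup_upper_bound.
have s1 : s <= 1 by apply: ge_sup => [|t [/andP[]]//]; exists 0.
have [r /= r0 hr] := (nbhs_ballP _ _).1 (hl s).
have {}hr t : `|s - t| < r -> `|h t - h s| <= c * `|t - s|.
  by move=> st; apply: hr; rewrite -ball_normE.
have As : A s.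
  split; first by rewrite s0.
  have [t At st] := sup_adherent r0 supA.
  have ts : t <= s by exact: sup_upper_bound.
  case: At => /andP[t0 t1] ht.
  have := hr t; rewrite ger0_norm ?subr_ge0// (distrC t) [`|s - t|]ger0_norm ?subr_ge0//.
  rewrite -/s in st.
  move=> /(_ ltac:(lra)) hst.
  rewrite -(subrKA (h t)) (le_trans (ler_normD _ _))// distrC; lra.
have [s1'|s1'] := ltP s 1; last first.
  have s1E : s = 1 by apply/eqP; rewrite eq_le s1 s1'.
  by case: As => _; rewrite s1E mulr1.
exfalso; pose t := Num.min 1 (s + r / 2).
have ts : s < t by rewrite lt_min s1' ltrDl divr_gt0.
have tr : t <= s + r / 2 by rewrite ge_min lexx orbT.
have t1 : t <= 1 by rewrite ge_min lexx.
suff /(sup_upper_bound supA) : A t by rewrite -/s leNgt ts.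
split; first by rewrite t1 andbT; lra.
have := hr t; rewrite distrC ger0_norm ?subr_ge0 ?(ltW ts)//.
move=> /(_ ltac:(lra)) hst; case: As => _ hs.
rewrite -(subrKA (h s)) (le_trans (ler_normD _ _))//; lra.
Qed.

End segment_lipschitz.

Section row_topology.
Variables (R : realType) (d : nat).
Implicit Types (y z n : 'rV[R]_d) (P : set 'rV[R]_d).

Lemma near_line y n P (t : R) : (\forall z \near (t *: n + y), P z) ->
  \forall s \near t, P (s *: n + y).
Proof.
have : (fun s : R => s *: n + y) s @[s --> t] --> t *: n + y.
  by apply: cvgD; [apply: cvgZr_tmp; exact: cvg_id|exact: cvg_cst].
by move=> h Py; exact: (h _ Py).
Qed.

Lemma near_line_gt0 y n P : (\forall z \near y, P z) ->
  exists e : R, 0 < e /\ forall t, 0 < t <= e -> P (t *: n + y).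
Proof.
rewrite -{1}[y]add0r -(scale0r n) => /near_line /nbhs_ballP[e /= e0 h].
exists (e / 2); split => [|t /andP[t0 te]]; first by rewrite divr_gt0.
by apply: h; rewrite -ball_normE /= sub0r normrN ger0_norm ?(ltW t0)//; lra.
Qed.

Lemma near_shift_row y z P : (\forall w \near z, P w) ->
  \forall w \near y, P (w + (z - y)).
Proof. by rewrite (near_shift y). Qed.

Lemma near_gt0 (g : 'rV[R]_d -> R) y : g z @[z --> y] --> g y ->
  0 < g y -> \forall z \near y, 0 < g z.
Proof.
move=> gc gy; suff h : nbhs (g y) [set r : R | 0 < r] by exact: (gc _ h).
by apply: open_nbhs_nbhs; split => //; exact: open_gt.
Qed.

Lemma near_forall_row (I : finType) (F : I -> set 'rV[R]_d) y :
  (forall i, \forall z \near y, F i z) -> \forall z \near y, forall i, F i z.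
Proof. exact: (@filter_forall _ _ _ _ (nbhs_filter y)). Qed.

Lemma lipschitz_of_local (g : 'rV[R]_d -> R) (c : R) :
  (forall y, \forall z \near y, `|g z - g y| <= c * `|z - y|) ->
  forall y z, `|g z - g y| <= c * `|z - y|.
Proof.
move=> gl y z; pose h t := g (t *: (z - y) + y).
have := @lipschitz_of_local_R R h (c * `|z - y|).
rewrite /h scale1r scale0r add0r subrK; apply => t.
apply: filterS (near_line (gl (t *: (z - y) + y))) => s.
move=> /le_trans; apply.
by rewrite opprD addrACA subrr addr0 -scalerBl normrZ -[leRHS]mulrA (mulrC `|z - y|).
Qed.

Lemma enorm_le_norm y : enorm y <= d%:R * `|y|.
Proof.
rewrite /enorm -(@ler_sqr R) ?nnegrE ?mulr_ge0 ?sqrtr_ge0//.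
rewrite sqr_sqrtr; last by rewrite sumr_ge0// => k _; rewrite -expr2 sqr_ge0.
apply: (@le_trans _ _ (\sum_(k < d) `|y| ^+ 2)).
  apply: ler_sum => k _; rewrite -expr2 -real_normK ?num_real//.
  by rewrite ler_sqr ?nnegrE//; exact: coord_le_norm.
rewrite sumr_const card_ord exprMn -[leLHS]mulr_natl ler_wpM2r ?sqr_ge0//.
by rewrite -natrX ler_nat; case: d => // m; rewrite leq_pmulr.
Qed.

(* Above a Lipschitz hypograph there is no point of its closure, so a
   neighbourhood of a boundary point always leaves the closure. *)
Lemma interior_closure_lipschitz (A : set 'rV[R]_d) :
  open A -> lipschitz_boundary A -> (closure A)° `<=` A.
Proof.
move=> oA lA y yA; apply: contrapT => nAy.
have bAy : boundary A y.
  by split; [exact: nbhs_singleton|move=> /nbhs_singleton].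
have [n [L [g [n1 gn gL hypo]]]] := lA _ bAy.
have gy : g y <= dot y n.
  by rewrite leNgt; apply/negP => /((nbhs_singleton hypo).2).
(* Moving along [n] raises the height but not [g], so [z] lies strictly above the graph. [near_join]
   makes the hypograph description valid around [z] itself, where it is confronted with points of
   [A] close to [z]. *)
have [e [e0 he]] := near_line_gt0 n (filterI yA (near_join hypo)).
have [|cA hypoz] := he e; first by rewrite e0 lexx.
set z := e *: n + y in cA hypoz.
have nz : dot z n - g z > 0.
  have -> : g z = g y by rewrite /z addrC gn.
  rewrite /z dotC dot_linear -enorm_sqr n1 expr1n mulr1 (dotC n); lra.
have cz : (dot w n - g w) @[w --> z] --> dot z n - g z.
  apply: (@lipschitz_at_cvg _ _ _ (\sum_k `|n 0 k| + `|L| * d%:R)).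
  near=> w.
  rewrite (_ : _ - _ = dot n (w - z) - (g w - g z)); last first.
    by rewrite dotBr !(dotC n); ring.
  rewrite mulrDl (le_trans (ler_normB _ _))// lerD// ?dot_le_norm//.
  apply: (le_trans (gL _ _)); rewrite -mulrA.
  apply: (@le_trans _ _ (`|L| * enorm (w - z))).
    by rewrite ler_wpM2r ?sqrtr_ge0// ler_norm.
  by rewrite ler_wpM2l// enorm_le_norm.
have [w [Aw [dgw]]] := cA _ (filterI (near_gt0 cz nz) hypoz).
by rewrite subr_gt0 in dgw; move=> hw; have := hw.1 Aw; rewrite ltNge (ltW dgw).
Unshelve. all: by end_near. Qed.

End row_topology.

Section mesh.
Variables (R : realType) (d N : nat) (x : 'I_N -> 'rV[R]_d).
Variables (C : {set {set 'I_N}}) (phi : 'I_N -> 'rV[R]_d -> R).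
Variables (a : {set 'I_N} -> 'I_N -> 'rV[R]_d) (b : {set 'I_N} -> 'I_N -> R).
Variable Om : set 'rV[R]_d.
Hypothesis phix : forall j i, phi j (x i) = (i == j)%:R.
Hypothesis bary : forall K, K \in C -> barycentric x phi K (a K) (b K).
Hypothesis coverC : \bigcup_(K in [set K | K \in C]) convex_hull x K = closure Om.
Hypothesis openOm : open Om.
Hypothesis lipOm : lipschitz_boundary Om.
Implicit Types (K : {set 'I_N}) (i j : 'I_N) (y z : 'rV[R]_d).

Definition bcoord K j y := dot (a K j) y + b K j.

(* For a simplex K of C this is the topological interior of its convex hull. *)
Definition open_cell K : set 'rV[R]_d := [set y | forall j, j \in K -> 0 < bcoord K j y].

Lemma bcoordB K j y z : bcoord K j y - bcoord K j z = dot (a K j) (y - z).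
Proof. by rewrite /bcoord dotBr; ring. Qed.

Lemma bcoord_notin K j y : K \in C -> j \notin K -> bcoord K j y = 0.
Proof.
by move=> /bary[_ _ _ h] /h[a0 b0]; rewrite /bcoord a0 b0 dot0l addr0.
Qed.

Lemma basis_cell K j y : K \in C -> convex_hull x K y -> phi j y = bcoord K j y.
Proof. by move=> /bary[h _ _ _]; exact: h. Qed.

Lemma cellP K y : K \in C -> convex_hull x K y <-> forall j, 0 <= bcoord K j y.
Proof. by move=> KC; exact: convex_hullP (bary KC) _. Qed.

Lemma open_cell_sub K : K \in C -> open_cell K `<=` convex_hull x K.
Proof.
move=> KC y Ky; apply/(cellP _ KC) => j.
by have [/Ky/ltW//|jK] := boolP (j \in K); rewrite bcoord_notin.
Qed.

Lemma cell_closure K : K \in C -> convex_hull x K `<=` closure Om.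
Proof. by move=> KC y Ky; rewrite -coverC; exists K. Qed.

Lemma closure_cell y : closure Om y -> exists2 K, K \in C & convex_hull x K y.
Proof. by rewrite -coverC => -[K KC Ky]; exists K. Qed.

Lemma near_bcoord_gt0 K j y : 0 < bcoord K j y ->
  \forall z \near y, 0 < bcoord K j z.
Proof. by apply: near_gt0; exact: continuous_affine. Qed.

Lemma near_open_cell K y : open_cell K y -> \forall z \near y, open_cell K z.
Proof.
move=> Ky; apply: near_forall_row => j.
have [jK|jK] := boolP (j \in K); last by near=> z.
by near=> z; move=> _; near: z; apply: near_bcoord_gt0; exact: Ky.
Unshelve. all: by end_near. Qed.

Lemma open_open_cell K : open (open_cell K).
Proof. by move=> y /near_open_cell. Qed.

(** An open cell is an open subset of the closure of [Om], hence part of its interior. *)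
Lemma open_cell_Om K : K \in C -> open_cell K `<=` Om.
Proof.
move=> KC y Ky; apply: (interior_closure_lipschitz openOm lipOm).
have h : open_cell K `<=` closure Om.
  by move=> z /(open_cell_sub KC); exact: cell_closure.
exact: filterS h (near_open_cell Ky).
Qed.

(** The global basis functions tell the cells apart: for a point in the open cell of [K], [phi j] is
    positive exactly when j is a vertex of [K]. *)
Lemma open_cell_disjoint K K' y : K \in C -> K' \in C ->
  open_cell K y -> open_cell K' y -> K = K'.
Proof.
have sub K1 K2 : K1 \in C -> K2 \in C -> open_cell K1 y -> open_cell K2 y ->
    K1 \subset K2.
  move=> C1 C2 y1 y2; apply/fintype.subsetP => j j1; apply: contraT => j2.
  have := y1 _ j1; rewrite -(basis_cell _ C1); last exact: open_cell_sub.
  by rewrite (basis_cell _ C2) ?bcoord_notin ?ltxx//; exact: open_cell_sub.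
by move=> KC KC' Ky Ky'; apply/eqP; rewrite finset.eqEsubset !sub.
Qed.

(** The cells are closed and finite in number, so those that miss [y] miss a whole neighbourhood of
    it. *)
Lemma near_cell y : \forall z \near y, forall K, K \in C ->
  convex_hull x K z -> convex_hull x K y.
Proof.
apply: near_forall_row => K.
have [[KC nK]|nK] := pselect (K \in C /\ ~ convex_hull x K y); last first.
  by near=> z => KC _; apply: contrapT => h; apply: nK.
have [j jy] : exists j, bcoord K j y < 0.
  apply: contrapT => h; apply: nK; apply/(cellP _ KC) => j.
  by rewrite leNgt; apply/negP => hj; apply: h; exists j.
have negE z : dot (- a K j) z - b K j = - bcoord K j z.
  by rewrite dotC -scaleN1r dotZr (dotC z) /bcoord; ring.
have : \forall z \near y, 0 < dot (- a K j) z - b K j.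
  by apply: near_gt0; [exact: continuous_affine|rewrite negE oppr_gt0].
apply: filterS => z; rewrite negE oppr_gt0 => jz _ /(cellP _ KC)/(_ j).
by rewrite leNgt jz.
Unshelve. all: by end_near. Qed.

(* Star argument: on the segment from y to the inner vertex x i the cells near a
   point y' of Om are exactly those containing y', and each of them contains the
   whole carrier face of y; shifting a neighbourhood of y' to y shows that y is
   interior. *)
Lemma basis_eq0_boundary i y : Om (x i) -> closure Om y -> ~ Om y -> phi i y = 0.
Proof.
move=> Oxi cy nOy; apply/eqP; apply: contraT => phiy0; exfalso; apply: nOy.
have [K0 K0C K0y] := closure_cell cy.
have phiE j : phi j y = bcoord K0 j y by exact: basis_cell.
have phi_ge0 j : 0 <= phi j y by rewrite phiE; exact: (cellP _ K0C).1.
have iK0 : i \in K0.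
  by apply: contraNT phiy0 => iK0; rewrite phiE bcoord_notin.
have phiy : 0 < phi i y by rewrite lt_neqAle eq_sym phiy0 phi_ge0.
have [e [e0 he]] := near_line_gt0 (y - x i) (openOm Oxi).
(* The cap 1 keeps [y'] on the segment, hence in [K0]; the bound [e] keeps it in [Om]. *)
pose s := Num.min e 1.
have s0 : 0 < s by rewrite lt_min e0 ltr01.
have s1 : s <= 1 by rewrite ge_min lexx orbT.
pose y' := s *: (y - x i) + x i.
have Oy' : Om y' by apply: he; rewrite s0 ge_min lexx.
have bx j : bcoord K0 j (x i) = (i == j)%:R.
  exact: barycentric_vertex phix (bary K0C) _ _ _.
have by' j : bcoord K0 j y' = s * phi j y + (1 - s) * (i == j)%:R.
  by rewrite phiE -bx /bcoord /y' dot_linear dotBr; ring.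
have K0y' : convex_hull x K0 y'.
  apply/(cellP _ K0C) => j.
  by rewrite by' addr_ge0// mulr_ge0 ?ler0n ?phi_ge0 ?subr_ge0// ltW.
have phiE' j : phi j y' = s * phi j y + (1 - s) * (i == j)%:R.
  by rewrite -by'; exact: basis_cell.
(* A vertex j with phi_j(y) > 0 also has phi_j(y') > 0, so it belongs to every cell containing [y'].
   Hence [y] is a convex combination of vertices of [K], with its weights from [K0]. *)
have same K j : K \in C -> convex_hull x K y' -> bcoord K j y = phi j y.
  move=> KC Ky'; have [_ L1 Lx _] := bary K0C.
  rewrite /bcoord [in LHS](Lx y) affine_comb//.
  rewrite (bigD1 j)//= big1 ?addr0 => [|l lj].
    have [jK|jK] := boolP (j \in K).
      rewrite -[dot (a K j) _ + _]/(bcoord K j (x j)).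
      rewrite /bcoord (barycentric_vertex phix (bary KC) _ jK) eqxx mulr1.
      by rewrite phiE.
    have : phi j y' = 0 by rewrite (basis_cell _ KC)// bcoord_notin.
    rewrite phiE' => h; have p0 : phi j y = 0.
      have := phi_ge0 j; have : 0 <= (1 - s) * (i == j)%:R.
        by rewrite mulr_ge0 ?ler0n ?subr_ge0.
      by move=> h1 h2; apply/eqP; rewrite eq_le h2 andbT; nra.
    by rewrite -/(bcoord K0 j y) -phiE p0 mul0r.
  have [lK|lK] := boolP (l \in K).
    by rewrite (barycentric_vertex phix (bary KC) _ lK) (negbTE lj) mulr0.
  have : phi l y' = 0 by rewrite (basis_cell _ KC)// bcoord_notin.
  rewrite phiE' => h; have p0 : phi l y = 0.
    have := phi_ge0 l; have : 0 <= (1 - s) * (i == l)%:R.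
      by rewrite mulr_ge0 ?ler0n ?subr_ge0.
    by move=> h1 h2; apply/eqP; rewrite eq_le h2 andbT; nra.
  by rewrite -/(bcoord K0 l y) -phiE p0 mul0r.
apply: (interior_closure_lipschitz openOm lipOm).
have pos : \forall z \near y, forall K j, 0 < bcoord K j y -> 0 < bcoord K j z.
  apply: near_forall_row => K; apply: near_forall_row => j.
  have [jy|jy] := boolP (0 < bcoord K j y); last by near=> z.
  by near=> z => _; near: z; exact: near_bcoord_gt0.
have ny := near_shift_row y (filterI (openOm Oy') (near_cell y')).
suff : \forall z \near y, closure Om z by [].
near=> z.
have posz : forall K j, 0 < bcoord K j y -> 0 < bcoord K j z by near: z; exact: pos.
have [] : Om (z + (y' - y)) /\ (forall K, K \in C ->
  convex_hull x K (z + (y' - y)) -> convex_hull x K y').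
  by near: z; exact: ny.
move=> /subset_closure/closure_cell[K KC Kz] /(_ K KC Kz) Ky'.
apply: (cell_closure KC); apply/(cellP _ KC) => j.
(* Coordinates positive at [y] stay positive at [z]. The others vanish at [y] and at [y'], so the
   shift by [y' - y] does not change them and nonnegativity passes from the shifted point to [z]. *)
have [jy|jy] := ltP 0 (phi j y).
  apply/ltW; rewrite -(same K j KC Ky') in jy.
  exact: posz.
have pj : phi j y = 0 by apply/eqP; rewrite eq_le jy phi_ge0.
have ij : i != j by apply: contraTN phiy => /eqP ->; rewrite pj ltxx.
have b0 : bcoord K j y = 0 by rewrite same.
have b0' : bcoord K j y' = 0.
  by rewrite -(basis_cell _ KC)// phiE' pj (negbTE ij) !mulr0 addr0.
have := (cellP _ KC).1 Kz j.
have -> : bcoord K j (z + (y' - y)) = bcoord K j z + (bcoord K j y' - bcoord K j y).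
  by rewrite bcoordB /bcoord dotDr; ring.
by rewrite b0 b0' subr0 addr0.
Unshelve. all: by end_near. Qed.

(* Extension of the basis function by zero; phi i is unspecified off the closure
   of Om. *)
Definition basis0 i y : R := if `[< Om y >] then phi i y else 0.

Lemma basis0_closure i y : Om (x i) -> closure Om y -> basis0 i y = phi i y.
Proof.
by move=> Oxi cy; rewrite /basis0; case: asboolP => // nOy; rewrite basis_eq0_boundary.
Qed.

(** It is enough to compare each [y] with nearby [z]. A cell containing [z] then also contains [y],
    even for [y] on the boundary, where the vanishing of [phi i] makes the extension agree with the
    affine piece. Summing over all cells makes the constant independent of the cell. *)
Lemma basis0_lipschitz i : Om (x i) ->
  exists c : R, forall y z, `|basis0 i z - basis0 i y| <= c * `|z - y|.
Proof.
move=> Oxi; exists (\sum_(K in C) \sum_k `|a K i 0 k|).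
apply: lipschitz_of_local => y.
have nO : \forall z \near y, Om y -> Om z.
  have [Oy|nOy] := pselect (Om y); last by near=> z.
  by near=> z => _; near: z; exact: openOm.
near=> z.
have Oyz : Om y -> Om z by near: z; exact: nO.
have cellz : forall K, K \in C -> convex_hull x K z -> convex_hull x K y.
  by near: z; exact: near_cell.
have [Oz|nOz] := pselect (Om z); last first.
  have nOy : ~ Om y.
    by move=> /Oyz.
  rewrite /basis0 asboolF// asboolF// subrr normr0 mulr_ge0// sumr_ge0// => K _.
  exact: sumr_ge0.
have [K KC Kz] := closure_cell (subset_closure Oz).
have Ky := cellz K KC Kz.
rewrite !basis0_closure//; try exact: (cell_closure KC).
rewrite !(basis_cell _ KC)// bcoordB (le_trans (dot_le_norm _ _))//.
rewrite ler_wpM2r// (bigD1 K)//= lerDl sumr_ge0// => K' _; exact: sumr_ge0.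
Unshelve. all: by end_near. Qed.

End mesh.

(** * Integrals over the mesh *)

Section mesh_integral.
Variables (R : realType) (d N : nat) (x : 'I_N -> 'rV[R]_d).
Variables (C : {set {set 'I_N}}) (phi : 'I_N -> 'rV[R]_d -> R).
Variables (a : {set 'I_N} -> 'I_N -> 'rV[R]_d) (b : {set 'I_N} -> 'I_N -> R).
Variable Om : set 'rV[R]_d.
Hypothesis phix : forall j i, phi j (x i) = (i == j)%:R.
Hypothesis cardC : forall K, K \in C -> (1 < #|K|)%N.
Hypothesis bary : forall K, K \in C -> barycentric x phi K (a K) (b K).
Hypothesis coverC : \bigcup_(K in [set K | K \in C]) convex_hull x K = closure Om.
Hypothesis openOm : open Om.
Hypothesis lipOm : lipschitz_boundary Om.
Hypothesis bndOm : bounded_set Om.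
Implicit Types (K : {set 'I_N}) (i j : 'I_N) (y z : 'rV[R]_d).

Notation T := (d.-tuple (measurableTypeR R)).
Notation mu := (lebesgue_tuple R d).
Notation bc := (bcoord a b).
Notation oc := (open_cell a b).

Let face (Kj : {set 'I_N} * 'I_N) : set T :=
  if (Kj.1 \in C) && (Kj.2 \in Kj.1)
  then [set t | dot (a Kj.1 Kj.2) (row_of_tuple t) + b Kj.1 Kj.2 = 0] else set0.

Definition skeleton : set T := \big[setU/set0]_Kj face Kj.

(** A second vertex, which exists because d >= 1, gives the coordinate the value 0 besides the value
    1 at [x j]. Thus the sets making up the skeleton are genuine hyperplanes. *)
Lemma barycentric_grad_neq0 K j : K \in C -> j \in K -> a K j != 0.
Proof.
move=> KC jK; apply/eqP => a0.
have [l lK lj] : exists2 l, l \in K & l != j.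
  have /card_gt0P[l] : (0 < #|K :\ j|)%N.
    by have := cardC KC; rewrite (cardsD1 j K) jK.
  by rewrite !inE => /andP[lj lK]; exists l.
have := barycentric_vertex phix (bary KC) j jK.
have := barycentric_vertex phix (bary KC) j lK.
rewrite a0 !dot0l eqxx (negbTE lj) => -> /esym/eqP.
by rewrite oner_eq0.
Qed.

Lemma skeleton_null : measurable skeleton /\ mu skeleton = 0%E.
Proof.
rewrite /skeleton; apply: (big_ind (fun A => measurable A /\ mu A = 0%E)).
- by split; [exact: measurable0|rewrite measure0].
- move=> A B [mA A0] [mB B0]; split; first exact: measurableU.
  by rewrite null_set_setU.
- move=> [K j] _; rewrite /face /=; case: ifPn => [/andP[KC jK]|_].
    split; first exact: measurable_hyperplane.
    by apply: hyperplane_null; exact: barycentric_grad_neq0.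
  by split; [exact: measurable0|rewrite measure0].
Qed.

Lemma off_skeleton (t : T) : closure Om (row_of_tuple t) -> ~ skeleton t ->
  exists2 K, K \in C & oc K (row_of_tuple t).
Proof.
move=> ct nt; have [K KC Kt] := closure_cell coverC ct.
exists K => // j jK; rewrite lt_neqAle (cellP phix bary _ KC).1// andbT.
apply/eqP => h; apply: nt; rewrite /skeleton (bigD1 (K, j))//=; left.
by rewrite /face /= KC jK /=.
Qed.

Lemma measurable_open_cell K : measurable [set t : T | oc K (row_of_tuple t)].
Proof. by apply: measurable_open_row; exact: open_open_cell. Qed.

Lemma domain_tbox : exists M : R, 0 <= M /\
  forall t : T, Om (row_of_tuple t) -> tbox M t.
Proof.
have [M [Mr hM]] := bndOm.
have M1 : M < `|M| + 1 by rewrite (le_lt_trans (ler_norm M))// ltrDl.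
exists (`|M| + 1); split; first by rewrite addr_ge0.
move=> t Ot i; have /= := hM _ M1 _ Ot; apply: le_trans.
by have := coord_le_norm (row_of_tuple t) i; rewrite mxE.
Qed.

Lemma open_cell_lty K : K \in C ->
  (mu [set t : T | oc K (row_of_tuple t)] < +oo)%E.
Proof.
move=> KC; have [M [_ hM]] := domain_tbox.
apply: le_lt_trans (@lebesgue_tbox_lty R d M); apply: le_measure.
- by rewrite inE; exact: measurable_open_cell.
- by rewrite inE; exact: measurable_tbox.
- by move=> t /= Kt; apply: hM; exact: (open_cell_Om phix bary coverC openOm lipOm KC).
Qed.

Lemma integrable_open_cell K (q : 'rV[R]_d -> R) (c : R) : K \in C ->
  measurable_fun setT (fun t : T => q (row_of_tuple t)) ->
  (forall y, oc K y -> `|q y| <= c) ->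
  mu.-integrable [set t : T | oc K (row_of_tuple t)]
    (EFin \o (fun t : T => q (row_of_tuple t))).
Proof.
move=> KC mq qc; apply: measurable_bounded_integrable.
- exact: measurable_open_cell.
- exact: open_cell_lty.
- exact: measurable_funTS.
- exists c; split; first exact: num_real.
  by move=> M cM t Kt; apply: le_trans (ltW cM); exact: qc.
Qed.

(** On each cell the integrands of the scheme are phi_i or 1 times a constant. Integrability is
    asked of the factor [q] alone, as [h] may contain classical gradients that are uncontrolled on
    the skeleton. *)
Lemma integral_cells (h : 'rV[R]_d -> R) (q : {set 'I_N} -> 'rV[R]_d -> R)
    (c : {set 'I_N} -> R) :
  (forall K, K \in C -> mu.-integrable [set t : T | oc K (row_of_tuple t)]
    (EFin \o (fun t : T => q K (row_of_tuple t)))) ->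
  (forall K y, K \in C -> oc K y -> h y = q K y * c K) ->
  integral_rV Om h = \sum_(K in C) integral_rV (oc K) (q K) * c K.
Proof.
move=> iq hq; have [mS S0] := skeleton_null.
pose S K := [set t : T | oc K (row_of_tuple t)].
have mSK K : measurable (S K) by exact: measurable_open_cell.
pose F K : T -> \bar R := if K \in C then
  (EFin \o (fun t : T => q K (row_of_tuple t) * c K)) \_ (S K) else cst 0%E.
have iqc K : K \in C ->
    mu.-integrable (S K) (EFin \o (fun t : T => q K (row_of_tuple t) * c K)).
  move=> KC; rewrite (_ : _ \o _ = (fun t => (c K)%:E * (q K (row_of_tuple t))%:E)%E).
    by apply: (integrableZl (mSK K)); exact: iq.
  by apply/funext => t /=; rewrite mulrC EFinM.
have iF K : mu.-integrable setT (F K).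
  rewrite /F; case: ifPn => KC; last exact: integrable0.
  by apply/(integrable_mkcond _ (mSK K)); exact: iqc.
have -> : integral_rV Om h = fine (\int[mu]_t \sum_(K in C) F K t)%E.
  rewrite /integral_rV /Rintegral; congr fine; rewrite integral_mkcond.
  apply: (eq_integral_off_null mS S0) => t _ nt.
  rewrite /patch; case: ifPn; rewrite ?inE /= => Ot.
    have [K KC Kt] := off_skeleton (subset_closure Ot) nt.
    rewrite (bigD1 K)//= big1 ?adde0 => [|K' /andP[KC' K'K]].
      by rewrite /F KC /patch mem_set //= (hq K).
    rewrite /F KC' /patch memNset// => K't; move/negP: K'K; apply; apply/eqP.
    exact: (open_cell_disjoint phix bary KC' KC K't Kt).
  rewrite big1 // => K KC; rewrite /F KC /patch memNset// => Kt.
  move: Ot; rewrite notin_setE; apply.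
  exact: (open_cell_Om phix bary coverC openOm lipOm KC).
rewrite integral_sum// -sum_fine => [|K KC]; last exact: integrable_fin_num.
apply: eq_bigr => K KC; rewrite /F KC -integral_mkcond.
rewrite -[LHS]/(Rintegral mu (S K) (fun t => q K (row_of_tuple t) * c K)).
by rewrite (RintegralZr _ (mSK K) (iq K KC)).
Qed.

End mesh_integral.

(** * Vanishing integral of a directional derivative *)

Section directional_derivative.
Variables (R : realType) (d N : nat) (x : 'I_N -> 'rV[R]_d).
Variables (C : {set {set 'I_N}}) (phi : 'I_N -> 'rV[R]_d -> R).
Variables (a : {set 'I_N} -> 'I_N -> 'rV[R]_d) (b : {set 'I_N} -> 'I_N -> R).
Variable Om : set 'rV[R]_d.
Hypothesis phix : forall j i, phi j (x i) = (i == j)%:R.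
Hypothesis cardC : forall K, K \in C -> (1 < #|K|)%N.
Hypothesis bary : forall K, K \in C -> barycentric x phi K (a K) (b K).
Hypothesis coverC : \bigcup_(K in [set K | K \in C]) convex_hull x K = closure Om.
Hypothesis openOm : open Om.
Hypothesis lipOm : lipschitz_boundary Om.
Hypothesis bndOm : bounded_set Om.
Variables (i : 'I_N) (w : 'rV[R]_d).
Hypothesis innerxi : Om (x i).
Implicit Types (K : {set 'I_N}) (y z : 'rV[R]_d).

Notation T := (d.-tuple (measurableTypeR R)).
Notation mu := (lebesgue_tuple R d).
Notation oc := (open_cell a b).
Notation psi := (basis0 phi Om i).

Let S K := [set t : T | oc K (row_of_tuple t)].

Lemma basis0_le1 y : `|psi y| <= 1.
Proof.
rewrite /basis0; case: asboolP => [Oy|_]; last by rewrite normr0 ler01.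
have [K KC Ky] := closure_cell coverC (subset_closure Oy).
have ge0 := (cellP phix bary y KC).1 Ky.
rewrite (basis_cell bary _ KC Ky) ger0_norm ?ge0//.
have [_ /(_ y) <- _ _] := bary KC.
by rewrite (bigD1 i)//= lerDl sumr_ge0// => j _; exact: ge0.
Qed.

Lemma integrable_tbox (g : T -> R) (c M : R) : measurable_fun setT g ->
  (forall t, `|g t| <= c) -> (forall t, ~ tbox M t -> g t = 0) ->
  mu.-integrable setT (EFin \o g).
Proof.
move=> mg gc g0; have mM := @measurable_tbox R d M.
rewrite (_ : EFin \o g = (EFin \o g) \_ (tbox M)); last first.
  apply/funext => t; rewrite /patch; case: ifPn => //=.
  by rewrite notin_setE => /g0 ->.
apply/(integrable_mkcond _ mM); apply: measurable_bounded_integrable => //.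
- exact: lebesgue_tbox_lty.
- exact: measurable_funTS.
- exists c; split; first exact: num_real.
  by move=> M' cM' t _; apply: le_trans (ltW cM'); exact: gc.
Qed.

Let step n : T := [tuple n.+1%:R^-1 * w 0 k | k < d].

Let row_step n : row_of_tuple (step n) = n.+1%:R^-1 *: w.
Proof. by apply/rowP => k; rewrite !mxE tnth_mktuple. Qed.

Let quot n (t : T) : R :=
  n.+1%:R * (psi (row_of_tuple (tadd (step n) t)) - psi (row_of_tuple t)).

(** The derivative of the extension along [w] off the skeleton, written with indicators so that it
    is measurable everywhere. *)
Let dpsi (t : T) : R := \sum_K (if K \in C then dot (a K i) w else 0) * \1_(S K) t.

Let measurable_psi : measurable_fun setT (fun t : T => psi (row_of_tuple t)).
Proof.
apply: measurable_continuous_row => y.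
have [c hc] := basis0_lipschitz phix bary coverC openOm lipOm innerxi.
by apply: (@lipschitz_at_cvg _ _ _ c); near=> z; exact: hc.
Unshelve. all: by end_near. Qed.

Let measurable_psi_shift n :
  measurable_fun setT (fun t : T => psi (row_of_tuple (tadd (step n) t))).
Proof. exact: (measurableT_comp measurable_psi (measurable_tadd (step n))). Qed.

(** All shifts have length at most [|w|], so one box carries all difference quotients and, with
    their Lipschitz bound, yields the dominating function. *)
Let support : exists M, forall t : T, ~ tbox M t ->
  psi (row_of_tuple t) = 0 /\ forall n, psi (row_of_tuple (tadd (step n) t)) = 0.
Proof.
have [M [M0 hM]] := domain_tbox bndOm; exists (M + `|w|) => t tM.
split=> [|m]; rewrite /basis0 asboolF// => /hM tM'; apply: tM => k.
  by rewrite (le_trans (tM' k))// lerDl.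
have := tM' k; rewrite !tnth_mktuple => h.
rewrite -[tnth t k](addKr (m.+1%:R^-1 * w 0 k)) (le_trans (ler_normD _ _))//.
rewrite addrC lerD// normrN normrM ger0_norm//.
apply: le_trans (coord_le_norm w k); rewrite ler_piMl//.
by rewrite invf_le1 ?ltr0n// ler1n.
Qed.

Let dpsiE t K : K \in C -> S K t -> dpsi t = dot (a K i) w.
Proof.
move=> KC Kt; rewrite /dpsi (bigD1 K)//= KC indicE mem_set// mulr1 big1 ?addr0//.
move=> K' K'K; case: ifPn => KC'; last by rewrite mul0r.
rewrite indicE memNset ?mulr0// => K't; move/negP: K'K; apply; apply/eqP.
exact: (open_cell_disjoint phix bary KC' KC K't Kt).
Qed.

Let dpsi0 t : ~ Om (row_of_tuple t) -> dpsi t = 0.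
Proof.
move=> nt; rewrite /dpsi big1// => K _; case: ifPn => KC; last by rewrite mul0r.
rewrite indicE memNset ?mulr0// => Kt; apply: nt.
exact: (open_cell_Om phix bary coverC openOm lipOm KC).
Qed.

Let near_quot (t : T) (P : set 'rV[R]_d) : (\forall y \near row_of_tuple t, P y) ->
  \forall n \near \oo, P (row_of_tuple (tadd (step n) t)).
Proof.
move=> Pt; have h : \forall s \near (0 : R), P (s *: w + row_of_tuple t).
  by apply: near_line; rewrite scale0r add0r.
have hn : \forall n \near \oo, P (harmonic n *: w + row_of_tuple t).
  exact: (@cvg_harmonic R _ h).
apply: filterS hn => n.
by rewrite row_of_tuple_tadd row_step.
Qed.

Let quot_cvg t : ~ skeleton C a b t -> (quot n t)%:E @[n --> \oo] --> (dpsi t)%:E.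
Proof.
(* Around a point off the skeleton the extension is affine or identically zero, so the quotients are
   eventually equal to their limit. *)
move=> nt; apply: cvg_near_cst.
have [ct|ct] := pselect (closure Om (row_of_tuple t)).
  have [K KC Kt] := off_skeleton phix bary coverC ct nt.
  have psiE y : oc K y -> psi y = bcoord a b K i y.
    move=> Ky; have Ky' := open_cell_sub phix bary KC Ky.
    rewrite (basis0_closure phix bary coverC openOm lipOm innerxi).
      exact: (basis_cell bary _ KC Ky').
    exact: (cell_closure coverC KC).
  apply: filterS (near_quot (near_open_cell Kt)) => n Kn.
  rewrite (dpsiE KC Kt) /quot !psiE// bcoordB row_of_tuple_tadd addrK row_step.
  by rewrite dotZr mulVKf// pnatr_eq0.
have psi0 y : ~ closure Om y -> psi y = 0.
  by move=> cy; rewrite /basis0 asboolF// => /subset_closure.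
have : \forall y \near row_of_tuple t, ~ closure Om y.
  by have /closed_openC := @closed_closure _ Om; apply.
move=> /near_quot hn; apply: filterS hn => n hn.
rewrite /quot !psi0// subrr mulr0 dpsi0// => /subset_closure.
exact: ct.
Qed.

Let quot_le : exists M c, forall t n, `|quot n t| <= c /\ (~ tbox M t -> quot n t = 0).
Proof.
have [M hM] := support; exists M.
have [c hc] := basis0_lipschitz phix bary coverC openOm lipOm innerxi.
exists (c * `|w|) => t n; split; last first.
  by move=> /hM[t0 tn]; rewrite /quot t0 tn subrr mulr0.
rewrite /quot normrM ger0_norm//.
have := hc (row_of_tuple t) (row_of_tuple (tadd (step n) t)).
rewrite row_of_tuple_tadd addrK row_step normrZ ger0_norm ?invr_ge0//.
rewrite -(ler_pM2l (ltr0Sn R n)) => /le_trans; apply.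
by rewrite mulrCA mulVKf// pnatr_eq0.
Qed.

Let integral_quot n : (\int[mu]_t (quot n t)%:E = 0)%E.
Proof.
have [M hM] := support.
have ip : mu.-integrable setT (EFin \o (fun t : T => psi (row_of_tuple t))).
  apply: (@integrable_tbox _ 1 M) => // t; first exact: basis0_le1.
  by move=> /hM[].
have ips : mu.-integrable setT
    (EFin \o (fun t : T => psi (row_of_tuple (tadd (step n) t)))).
  apply: (@integrable_tbox _ 1 M) => // t; first exact: basis0_le1.
  by move=> /hM[].
rewrite (_ : (fun t => _) = (fun t => n.+1%:R%:E *
  ((psi (row_of_tuple (tadd (step n) t)))%:E - (psi (row_of_tuple t))%:E))%E); last first.
  by apply/funext => t; rewrite -EFinB -EFinM.
rewrite integralZl//; last exact: integrableB.
rewrite integralB//.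
rewrite (@integral_tuple_shift _ _ (step n) (fun t => (psi (row_of_tuple t))%:E))//.
  by rewrite subee ?mule0//; exact: integrable_fin_num.
exact/measurable_EFinP.
Qed.

(* By translation invariance the difference quotients of basis0 in the direction
   w have integral 0, and they converge boundedly to its derivative. *)
Lemma integral_derivative_eq0 (h : 'rV[R]_d -> R) :
  (forall K y, K \in C -> oc K y -> h y = dot (a K i) w) ->
  integral_rV Om h = 0.
Proof.
move=> hE; have [mS S0] := skeleton_null phix cardC bary.
have mdpsi : measurable_fun setT dpsi.
  apply: measurable_sum => K; apply: measurable_funM => //.
  by apply: measurable_indic; exact: measurable_open_cell.
have -> : integral_rV Om h = fine (\int[mu]_t (dpsi t)%:E)%E.
  rewrite /integral_rV /Rintegral; congr fine; rewrite integral_mkcond.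
  apply: (eq_integral_off_null mS S0) => t _ nt.
  rewrite /patch; case: ifPn; rewrite ?inE ?notin_setE /= => Ot.
    have [K KC Kt] := off_skeleton phix bary coverC (subset_closure Ot) nt.
    by rewrite (dpsiE KC Kt) (hE K).
  by rewrite dpsi0.
have [M [c hc]] := quot_le.
have mM := @measurable_tbox R d M.
have [] := @dominated_convergence _ T R mu setT measurableT
  (fun n t => (quot n t)%:E) (EFin \o dpsi) ((EFin \o cst c) \_ (tbox M)).
- move=> n; apply/measurable_EFinP/measurable_funM => //.
  exact: measurable_funB.
- exact/measurable_EFinP.
- exists (skeleton C a b); split => // t; apply: contra_notP => nt _.
  exact: quot_cvg.
- apply/(integrable_mkcond _ mM); apply: measurable_bounded_integrable => //.
    exact: lebesgue_tbox_lty.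
  exists c; split; first exact: num_real.
  move=> M' cM' t _ /=; apply: le_trans (ltW cM').
  by rewrite ger0_norm//; exact: le_trans (hc t 0).1.
- apply: aeW => t n _; have [q1 q2] := hc t n.
  rewrite /patch; case: ifPn => /=; rewrite ?lee_fin// notin_setE => /q2 ->.
  by rewrite normr0.
move=> _ _; rewrite (_ : [sequence _]_n = cst 0%E); last first.
  by apply/funext => n /=; exact: integral_quot.
move=> h0; suff -> : (\int[mu]_t (dpsi t)%:E = 0)%E by [].
exact: (cvg_unique (@ereal_hausdorff R) h0 (cvg_cst 0%E)).
Qed.

End directional_derivative.

(** * The scheme at the equilibrium *)

Lemma mesh_barycentric (R : realType) (d N : nat) (p : problem R d)
    (t : discretization R d N) :
  conforming_simplex_mesh p t -> lagrange_basis p t ->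
  exists (a : {set 'I_N} -> 'I_N -> 'rV[R]_d) (b : {set 'I_N} -> 'I_N -> R),
    forall K, K \in cells t -> barycentric (vertex t) (Defs.basis t) K (a K) (b K).
Proof.
move=> [_ _ cK _ _] lag.
have /choice[ab abE] K : exists ab : ('I_N -> 'rV[R]_d) * ('I_N -> R),
    K \in cells t -> barycentric (vertex t) (Defs.basis t) K ab.1 ab.2.
  have [KC|KC] := boolP (K \in cells t); last by exists (fun=> 0, fun=> 0).
  have [cardK indK] := cK K KC.
  have [||ab hab] := @barycentric_exists _ _ _ (vertex t) (Defs.basis t) K cardK indK.
  - by move=> j; have [_ h _] := lag j; exact: h.
  - by move=> j; have [_ _ h] := lag j.
  by exists ab.
by exists (fun K => (ab K).1), (fun K => (ab K).2).
Qed.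

Section constant_coefficients.
Variables (R : realType) (d N : nat).
Variables (p : problem R d) (t : discretization R d N).
Hypothesis d_gt0 : (0 < d)%N.
Hypothesis hp : problem_wf p.
Hypothesis mesh : conforming_simplex_mesh p t.
Hypothesis lag : lagrange_basis p t.
Variables (vhat : 'rV[R]_d) (fhat : R).
Hypothesis velE : forall y, closure (Omega p) y -> vel p y = vhat.
Hypothesis reactE : forall y, closure (Omega p) y -> react p y = 0.
Hypothesis srcE : forall y, closure (Omega p) y -> src p y = fhat.
Variables (a : {set 'I_N} -> 'I_N -> 'rV[R]_d) (b : {set 'I_N} -> 'I_N -> R).
Hypothesis bary : forall K, K \in cells t ->
  barycentric (vertex t) (Defs.basis t) K (a K) (b K).
Implicit Types (K : {set 'I_N}) (i j : 'I_N).

Notation Om := (Omega p).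
Notation x := (vertex t).
Notation C := (cells t).
Notation phi := (Defs.basis t).
Notation bc := (bcoord a b).
Notation oc := (open_cell a b).

Let phix j i : phi j (x i) = (i == j)%:R.
Proof. by have [_ _] := lag j. Qed.

Let cardC K : K \in C -> (1 < #|K|)%N.
Proof. by case: mesh => _ _ cK _ _ /cK[-> _]; rewrite ltnS. Qed.

Let coverC : \bigcup_(K in [set K | K \in C]) convex_hull x K = closure Om.
Proof. by case: mesh. Qed.

Let openOm : open Om. Proof. by case: hp => -[[]]. Qed.
Let lipOm : lipschitz_boundary Om. Proof. by case: hp => -[_ []]. Qed.
Let bndOm : bounded_set Om. Proof. by case: hp => -[_ []]. Qed.

Lemma vertex_closure i : closure Om (x i).
Proof.
have [_ /(_ i)[K KC iK] _ _ _] := mesh.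
exact: (cell_closure coverC KC (vertex_convex_hull x iK)).
Qed.

Let open_cell_closure K y : K \in C -> oc K y -> closure Om y.
Proof.
by move=> KC Ky; exact: (cell_closure coverC KC (open_cell_sub phix bary KC Ky)).
Qed.

Let basis_open_cell K j y : K \in C -> oc K y -> phi j y = bc K j y.
Proof. by move=> KC Ky; exact: (basis_cell bary _ KC (open_cell_sub phix bary KC Ky)). Qed.

Lemma grad_basis K j y : K \in C -> oc K y -> grad (phi j) y = a K j.
Proof.
move=> KC /near_open_cell Ky; apply: (@grad_affine _ _ _ _ (b K j)).
by apply: filterS Ky => z; exact: basis_open_cell.
Qed.

Definition cell_basis_integral K i : R := integral_rV (oc K) (bc K i).
Definition cell_volume K : R := integral_rV (oc K) (fun=> 1).

Let integral_cells_basis i (h : 'rV[R]_d -> R) (c : {set 'I_N} -> R) :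
  (forall K y, K \in C -> oc K y -> h y = bc K i y * c K) ->
  integral_rV Om h = \sum_(K in C) cell_basis_integral K i * c K.
Proof.
move=> hc; rewrite /cell_basis_integral /cell_volume.
apply: (integral_cells phix cardC bary coverC openOm lipOm
  (q := fun K => bc K i) _ hc) => K KC.
apply: (integrable_open_cell phix bary coverC openOm lipOm bndOm KC (c := 1)).
  exact: measurable_affine_row.
move=> y Ky; have ge0 := (cellP phix bary y KC).1 (open_cell_sub phix bary KC Ky).
rewrite ger0_norm ?ge0//; have [_ /(_ y) <- _ _] := bary KC.
by rewrite (bigD1 i)//= lerDl sumr_ge0// => j _; exact: ge0.
Qed.

Let integral_cells_cst (h : 'rV[R]_d -> R) (c : {set 'I_N} -> R) :
  (forall K y, K \in C -> oc K y -> h y = c K) ->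
  integral_rV Om h = \sum_(K in C) cell_volume K * c K.
Proof.
move=> hc; rewrite /cell_basis_integral /cell_volume.
apply: (integral_cells phix cardC bary coverC openOm lipOm
  (q := fun _ _ => 1)) => K; last by move=> y KC Ky; rewrite mul1r; exact: hc.
move=> KC; apply: (integrable_open_cell phix bary coverC openOm lipOm bndOm KC
  (q := fun=> 1) (c := 1)) => //.
by move=> y _; rewrite normr1.
Qed.

Lemma aR_eq0 i j : aR p t i j = 0.
Proof.
rewrite /aR (@integral_cells_cst _ (fun=> 0)); first by rewrite big1// => K _; rewrite mulr0.
by move=> K y KC /(open_cell_closure KC)/reactE ->; rewrite !mul0r.
Qed.

Lemma load_cells i : load p t i = \sum_(K in C) cell_basis_integral K i * fhat.
Proof.
apply: integral_cells_basis => K y KC Ky.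
by rewrite (basis_open_cell _ KC Ky) srcE//; exact: open_cell_closure Ky.
Qed.

Lemma aC_cells i j :
  aC p t i j = \sum_(K in C) cell_basis_integral K i * dot vhat (a K j).
Proof.
apply: (integral_cells_basis (c := fun K => dot vhat (a K j))) => K y KC Ky.
rewrite (basis_open_cell _ KC Ky) (grad_basis _ KC Ky) velE//.
exact: open_cell_closure Ky.
Qed.

Lemma aD_cells i j :
  aD p t i j = eps p * \sum_(K in C) cell_volume K * dot (a K i) (a K j).
Proof.
congr (_ * _); apply: (integral_cells_cst (c := fun K => dot (a K i) (a K j))).
by move=> K y KC Ky; rewrite !(grad_basis _ KC Ky).
Qed.

(** The constant [c] serves two uses: c = 0 in the Galerkin residual and c = - u_i for the
    differences u_j - u_i of the flux form. *)
Lemma sum_aC_affine i (g : 'rV[R]_d) (c : R) :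
  \sum_j aC p t i j * (dot g (x j) + c) =
  \sum_(K in C) cell_basis_integral K i * dot vhat g.
Proof.
under eq_bigr do rewrite aC_cells mulr_suml.
rewrite exchange_big /=; apply: eq_bigr => K KC.
rewrite -{2}(barycentric_sum (bary KC) g c) dot_sumr mulr_sumr.
by apply: eq_bigr => j _; rewrite dotZr; ring.
Qed.

Lemma sum_aD_affine i (g : 'rV[R]_d) (c : R) :
  \sum_j aD p t i j * (dot g (x j) + c) =
  eps p * \sum_(K in C) cell_volume K * dot (a K i) g.
Proof.
under eq_bigr do rewrite aD_cells -mulrA mulr_suml.
rewrite -mulr_sumr exchange_big /=; congr (_ * _); apply: eq_bigr => K KC.
rewrite -{2}(barycentric_sum (bary KC) g c) dot_sumr mulr_sumr.
by apply: eq_bigr => j _; rewrite dotZr; ring.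
Qed.

Lemma notin_nbr i j K : j \notin nbr t i -> K \in C -> i \in K -> j \notin K.
Proof.
move=> ij KC iK; apply: contraNN ij => jK.
by rewrite inE; apply/exists_inP; exists K => //; rewrite iK.
Qed.

Lemma aC_notin_nbr i j : j \notin nbr t i -> aC p t i j = 0.
Proof.
move=> ij; rewrite aC_cells big1// => K KC; have [iK|iK] := boolP (i \in K).
  have [_ _ _ h] := bary KC; have [-> _] := h _ (notin_nbr ij KC iK).
  by rewrite dot0r mulr0.
rewrite /cell_basis_integral /integral_rV /Rintegral integral0_eq ?mul0r//.
by move=> s _; rewrite (bcoord_notin bary _ KC iK).
Qed.

Lemma aD_notin_nbr i j : j \notin nbr t i -> aD p t i j = 0.
Proof.
move=> ij; rewrite aD_cells big1 ?mulr0// => K KC; have [_ _ _ h] := bary KC.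
have [iK|iK] := boolP (i \in K).
  by have [-> _] := h _ (notin_nbr ij KC iK); rewrite dot0r mulr0.
by have [-> _] := h _ iK; rewrite dot0l mulr0.
Qed.

Lemma sum_cell_grad_eq0 i (g : 'rV[R]_d) : dirichlet_vertices p t ->
  (i < nfree t)%N -> eps p * \sum_(K in C) cell_volume K * dot (a K i) g = 0.
Proof.
move=> [_ dir] ifree; have [_ eps0 epsG _] := hp.
have [->|epsn0] := eqVneq (eps p) 0; first by rewrite mul0r.
(* For eps > 0 the Dirichlet part is the whole boundary, so a free vertex lies in the closure but
   not on the boundary. *)
have Oi : Om (x i).
  have nb : ~ boundary Om (x i).
    by rewrite -epsG ?lt_neqAle ?eps0 1?eq_sym ?epsn0// => /dir; rewrite leqNgt ifree.
  apply: contrapT => nOi; apply: nb; split; first exact: vertex_closure.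
  by move=> /nbhs_singleton.
rewrite -(@integral_cells_cst (fun y => dot (grad (phi i) y) g) (fun K => dot (a K i) g)).
  rewrite (integral_derivative_eq0 phix cardC bary coverC openOm lipOm bndOm Oi (w := g)).
    by rewrite mulr0.
  by move=> K y KC Ky; rewrite (grad_basis _ KC Ky).
by move=> K y KC Ky; rewrite (grad_basis _ KC Ky).
Qed.

(** All coordinates equal 1/#|K| there. Since [cell_grad] differentiates at this point, the finite
    element function is affine around it. *)
Lemma barycenter_open_cell K : K \in C ->
  oc K (#|K|%:R^-1 *: \sum_(i in K) x i).
Proof.
move=> KC j jK; have K0 : #|K|%:R != 0 :> R.
  by rewrite pnatr_eq0 -lt0n (leq_trans _ (cardC KC)).
suff -> : bc K j (#|K|%:R^-1 *: \sum_(i in K) x i) = #|K|%:R^-1.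
  by rewrite invr_gt0 lt_neqAle eq_sym K0 ler0n.
rewrite /bcoord dotZr dot_sumr.
have -> : \sum_(i in K) dot (a K j) (x i) = 1 - #|K|%:R * b K j.
  rewrite (eq_bigr (fun i => (i == j)%:R - b K j)) => [|i iK].
    rewrite sumrB sumr_const mulr_natl (bigD1 j)//= eqxx big1 ?addr0//.
    by move=> l /andP[_ /negbTE ->].
  by rewrite -(barycentric_vertex phix (bary KC) j iK) addrK.
by field.
Qed.

Lemma cell_grad_affine K (g : 'rV[R]_d) : K \in C ->
  cell_grad t (fe_function t (fun j => dot g (x j))) K = g.
Proof.
move=> KC; apply: (@grad_affine _ _ _ _ 0).
have := near_open_cell (barycenter_open_cell KC); apply: filterS => z Kz.
have [_ _ /(_ z) zE _] := bary KC.
rewrite addr0 [in RHS]zE dot_sumr; apply: eq_bigr => j _.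
by rewrite dotZr (basis_open_cell _ KC Kz) mulrC.
Qed.

Section equilibrium.
Hypothesis vhat0 : vhat != 0.
Let g := (fhat / dot vhat vhat) *: vhat.
Let u i := dot g (x i).

Let dot_vhat_g : dot vhat g = fhat.
Proof. by rewrite /g dotZr divfK// gt_eqF// dot_gt0. Qed.

Lemma Pij_equilibrium i j : Pij p t u i j = (u i - u j) / 2.
Proof.
rewrite /Pij /nodal_source !srcE ?reactE ?velE; try exact: vertex_closure.
rewrite !mul0r !subr0 maxxx enorm_sqr dotDr.
rewrite /u -dotBr /g [dot (_ *: _) _]dotC dotZr.
have : dot vhat vhat != 0 by rewrite gt_eqF// dot_gt0.
by move=> ?; field.
Qed.

Lemma alpha_equilibrium i j : upwind_cells_wf t -> (i < nfree t)%N ->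
  j \in nbr' t i -> alpha p t u i j = 1.
Proof.
move=> upw.
have R1 k l : l \in nbr' t k -> Rij p t u k l = 1.
  move=> lk; rewrite /Rij; case: ifP => // kfree.
  have [KC _ _] := upw k l kfree lk.
  have uextE : (uext t u k l - u k) / 2 = (u k - u l) / 2.
    by rewrite /uext (cell_grad_affine _ KC) dotBr addrC addKr.
  (* P_kl is itself an entry of the maximum [Qplus] and of the minimum [Qminus], so neither strict
     inequality that triggers limiting can hold, whatever the sign of the load. *)
  rewrite Pij_equilibrium !ltNge.
  rewrite /Qplus le_max uextE lexx andbF.
  by rewrite /Qminus ge_min uextE lexx andbF.
move=> ifree ij; rewrite /alpha !R1 ?minxx//.
move: ij; rewrite !inE eq_sym => /andP[-> /=] /exists_inP[K KC].
by rewrite andbC => hK; apply/exists_inP; exists K.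
Qed.

Lemma flux_equilibrium i j : upwind_cells_wf t -> (i < nfree t)%N ->
  j \in nbr' t i -> flux_s p t u i j = 0.
Proof.
move=> upw ifree ij.
by rewrite /flux_s alpha_equilibrium// Pij_equilibrium aR_eq0; ring.
Qed.

Let sum_nbr i (m : 'I_N -> R) : (forall j, j \notin nbr t i -> m j = 0) ->
  \sum_j m j * (u j - u i) = \sum_(j in nbr' t i) m j * (u j - u i).
Proof.
move=> m0; rewrite [RHS]big_mkcond; apply: eq_bigr => j _; case: ifPn => //.
rewrite !inE negb_and negbK => /orP[/eqP ->|jn]; first by rewrite subrr mulr0.
by rewrite m0 ?mul0r// inE.
Qed.

Lemma load_equilibrium i :
  load p t i = \sum_(j in nbr' t i) aC p t i j * (u j - u i).
Proof.
rewrite -sum_nbr => [|j]; last exact: aC_notin_nbr.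
by rewrite (sum_aC_affine i g (- u i)) dot_vhat_g load_cells.
Qed.

Lemma diffusion_equilibrium i : dirichlet_vertices p t -> (i < nfree t)%N ->
  \sum_(j in nbr' t i) aD p t i j * (u j - u i) = 0.
Proof.
move=> dir ifree; rewrite -sum_nbr => [|j]; last exact: aD_notin_nbr.
by rewrite (sum_aD_affine i g (- u i)) sum_cell_grad_eq0.
Qed.

Lemma galerkin_equilibrium i : dirichlet_vertices p t -> (i < nfree t)%N ->
  galerkin_residual p t u i = 0.
Proof.
move=> dir ifree; rewrite /galerkin_residual.
rewrite (eq_bigr (fun j => aD p t i j * (dot g (x j) + 0) +
  aC p t i j * (dot g (x j) + 0))) => [|j _]; last by rewrite aR_eq0 /u; ring.
rewrite big_split /= sum_aC_affine sum_aD_affine sum_cell_grad_eq0//.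
by rewrite dot_vhat_g load_cells add0r subrr.
Qed.

Let dij_ge_aC i j : `|aC p t i j| <= dij p t i j.
Proof. by rewrite /dij le_max lexx. Qed.

Lemma wmc_equilibrium i : upwind_cells_wf t -> dirichlet_vertices p t ->
  (i < nfree t)%N -> wmc_residual p t u i = 0.
Proof.
move=> upw dir ifree.
(* Division by zero returns 0, so a vanishing [aC_row] would lose the load. In that case every [dij]
   of the row is 0, hence so is every [aC] and, by the convection balance, the load. *)
have load0 : aC_row p t i = 0 -> load p t i = 0.
  move=> /eqP; rewrite psumr_eq0 => [/allP h|j _]; last first.
    by rewrite mulr_ge0// (le_trans (normr_ge0 _) (dij_ge_aC i j)).
  rewrite load_equilibrium big1// => j ij.
  have := h j (mem_index_enum j); rewrite ij mulf_eq0 pnatr_eq0 /= => /eqP d0.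
  by have := dij_ge_aC i j; rewrite d0 normr_le0 => /eqP ->; rewrite mul0r.
rewrite /wmc_residual /aR_row big1 => [|j _]; last exact: aR_eq0.
rewrite mul0r sub0r.
(* In [ubar_s - u i] the term P = (u_i - u_j)/2 cancels the (u_j - u_i)/2 of the bar state. The
   artificial diffusion disappears, leaving the convection entry and a share of the load; the shares
   add up to the load. *)
rewrite (eq_bigr (fun j => 2 * dij p t i j * (load p t i / aC_row p t i) -
    aC p t i j * (u j - u i) - aD p t i j * (u j - u i))) => [|j ij].
  rewrite !sumrB diffusion_equilibrium// -load_equilibrium -mulr_suml.
  rewrite -/(aC_row p t i).
  have [r0|r0] := eqVneq (aC_row p t i) 0; first by rewrite load0// r0 mul0r !subr0 oppr0.
  by rewrite mulrC divfK// subrr subr0 oppr0.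
congr (_ - _); rewrite /ubar_s_star /flux_s_star flux_equilibrium// eqxx mul0r addr0.
rewrite /ubar_s alpha_equilibrium// Pij_equilibrium /ubar.
(* When [dij] is 0 the quotient in [ubar] has the default value 0, in agreement with [aC], which is
   then 0 as well. *)
have [d0|d0] := eqVneq (dij p t i j) 0.
  have := dij_ge_aC i j; rewrite d0 normr_le0 => /eqP ->; ring.
set r := load p t i / aC_row p t i.
by field.
Qed.

End equilibrium.
End constant_coefficients.

Theorem mainTheorem6 (R : realType) (d N : nat) (hd : (1 <= d <= 3)%N)
    (p : problem R d) (t : discretization R d N)
    (hp : problem_wf p) (ht : discretization_wf p t)
    (vhat : 'rV[R]_d) (fhat : R) (hv : vhat != 0) (hf : fhat != 0)
    (velE : forall y, closure (Omega p) y -> vel p y = vhat)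
    (reactE : forall y, closure (Omega p) y -> react p y = 0)
    (srcE : forall y, closure (Omega p) y -> src p y = fhat) :
  let uhat := fun y : 'rV[R]_d => fhat * (dot y vhat / enorm vhat ^+ 2) in
  let u := fun i : 'I_N => uhat (vertex t i) in
  (forall i j : 'I_N, (i < nfree t)%N -> j \in nbr t i :\ i ->
     [/\ alpha p t u i j = 1, flux_s p t u i j = 0 &
         flux_s_star p t u i j = 0]) /\
  (forall i : 'I_N, (i < nfree t)%N ->
     wmc_residual p t u i = galerkin_residual p t u i /\
     galerkin_residual p t u i = 0).
Proof.
move=> uhat u.
have [d_gt0 _] := andP hd.
have [[mesh lag dir upw _] _] := ht.
have [a [b bary]] := mesh_barycentric mesh lag.
have -> : u = fun i => dot ((fhat / dot vhat vhat) *: vhat) (vertex t i).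
  apply/funext => i; rewrite /u /uhat enorm_sqr [in RHS]dotC dotZr.
  by rewrite mulrA mulrAC.
split=> [i j ifree ij|i ifree].
  have f0 := flux_equilibrium d_gt0 hp mesh lag velE reactE srcE bary hv upw ifree ij.
  split => //; last by rewrite /flux_s_star f0 eqxx.
  exact: (alpha_equilibrium d_gt0 mesh lag velE reactE srcE bary hv upw ifree ij).
have g0 := galerkin_equilibrium d_gt0 hp mesh lag velE reactE srcE bary hv dir ifree.
split => //; rewrite g0.
exact: (wmc_equilibrium d_gt0 hp mesh lag velE reactE srcE bary hv upw dir ifree).
Qed.
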